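(* Let $K$ be a field of characteristic zero and let $R$ be an integral domain which is a regular ring and the localisation of a finitely generated $K$-algebra, and which has a maximal ideal $\mathfrak m$ such that $R/\mathfrak m$ is a finite extension of $K$. Let $M$ be a finitely generated $R$-module. (i) The map $\mathrm{Der}(R/K)\to\mathrm{ID}_K(R)$, $\partial\mapsto\phi_\partial$, given by $\phi_\partial(r):=\sum_{n\ge0}\frac1{n!}\partial^n(r)T^n$, is a bijection with inverse $\phi\mapsto\phi^{(1)}$. For a given derivation $\partial\in\mathrm{Der}(R/K)$ and the corresponding iterative derivation $\phi_\partial$, the map $\mathrm{Der}_\partial(M)\to\mathrm{ID}(M,\phi_\partial)$, $\partial_M\mapsto\Phi_{\partial_M}$, given by $\Phi_{\partial_M}(m):=\sum_{n\ge0}\frac1{n!}\partial_M^n(m)T^n$, is a bijection with inverse $\Phi\mapsto\Phi^{(1)}$. (ii) The $R$-module $(\hat\Omega_{R/K})_1$ is canonically isomorphic to the module of (ordinary) differentials $\Omega_{R/K}$, and $d^{(1)}:R\to(\hat\Omega_{R/K})_1\cong\Omega_{R/K}$ is the universal derivation. (iii) For every iterative connection $\nabla$ on $M$, the map $\nabla^{(1)}:M\to(\hat\Omega_{R/K})_1\otimes_RM\cong\Omega_{R/K}\otimes_RM$ is a connection on $M$, and every connection $\nabla^{(1)}$ on $M$ uniquely extends to an iterative connection on $M$. Furthermore, an iterative connection $\nabla$ is an integrable iterative connection if and only if $\nabla^{(1)}$ is an integrable connection.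
   Context: $\mathrm{Der}(R/K)$ is the set of $K$-derivations $R\to R$. For $\partial\in\mathrm{Der}(R/K)$, $\mathrm{Der}_\partial(M)$ is the set of additive maps $\partial_M:M\to M$ with $\partial_M(rm)=\partial(r)m+r\partial_M(m)$. Higher derivations. $\mathrm{HD}_K(R)$ is the set of $K$-algebra homomorphisms $\psi:R\to R[[T]]$, $\psi(r)=\sum_k\psi^{(k)}(r)T^k$, with $\psi^{(0)}=\mathrm{id}$. For $\psi\in\mathrm{HD}_K(R)$ put $\psi[[T]](\sum a_iT^i)=\sum\psi(a_i)T^i$ and $\psi_1\psi_2:=\psi_1[[T]]\circ\psi_2$. $\mathrm{ID}_K(R)$ is the subset of iterative derivations, i.e. those with $\phi^{(i)}\circ\phi^{(j)}=\binom{i+j}{i}\phi^{(i+j)}$ for all $i,j\ge0$. For $\phi\in\mathrm{ID}_K(R)$, $\mathrm{ID}(M,\phi)$ is the set of additive maps $\Phi:M\to M[[T]]$, $\Phi(m)=\sum_k\Phi^{(k)}(m)T^k$, with $\Phi^{(0)}=\mathrm{id}_M$, $\Phi(rm)=\phi(r)\Phi(m)$ and $\Phi^{(i)}\circ\Phi^{(j)}=\binom{i+j}{i}\Phi^{(i+j)}$. Algebra of higher differentials. $\hat\Omega=\hat\Omega_{R/K}=\prod_k\hat\Omega_k$ is the completion by degree of the graded commutative $R$-algebra generated by symbols $d^{(k)}r$ ($k\ge1$, $r\in R$), of degree $k$, modulo $d^{(k)}(r+s)=d^{(k)}r+d^{(k)}s$, $d^{(k)}a=0$ for $a\in K$, $d^{(k)}(rs)=\sum_{i=0}^kd^{(i)}r\,d^{(k-i)}s$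 (with $d^{(0)}r:=r$). Set $d_R(r)=\sum_kd^{(k)}r$, and let $d_{\hat\Omega}$ be the continuous $K$-algebra automorphism of $\hat\Omega$ with $d_{\hat\Omega}(d^{(i)}r)=\sum_{j\ge0}\binom{i+j}{j}d^{(i+j)}r$. For $\psi\in\mathrm{HD}_K(R)$, $\tilde\psi:\hat\Omega\to R[[T]]$ is the continuous $R$-algebra homomorphism with $d^{(k)}r\mapsto\psi^{(k)}(r)T^k$. Connections. $\hat\Omega\otimes_RM$ denotes $\prod_k\hat\Omega_k\otimes_RM$. A higher connection on $M$ is an additive map $\nabla=\sum_k\nabla^{(k)}:M\to\hat\Omega\otimes_RM$ with $\nabla(rm)=d_R(r)\nabla(m)$ and $\nabla^{(0)}=\mathrm{id}_M$. Put ${}_{\hat\Omega}\nabla(\omega\otimes x)=d_{\hat\Omega}(\omega)\nabla(x)$, with ${}_{\hat\Omega}\nabla^{(i)}$ the part raising degrees by $i$. $\nabla$ is iterative if ${}_{\hat\Omega}\nabla^{(i)}\circ{}_{\hat\Omega}\nabla^{(j)}=\binom{i+j}{i}{}_{\hat\Omega}\nabla^{(i+j)}$ for all $i,j\ge0$. Put $\nabla_\psi=(\tilde\psi\otimes\mathrm{id}_M)\circ\nabla:M\to M[[T]]$ and $\nabla_{\psi_1}\nabla_{\psi_2}:=\nabla_{\psi_1}[[T]]\circ\nabla_{\psi_2}$, where $\nabla_\psi[[T]](\sum m_iT^i)=\sum\nabla_\psi(m_i)T^i$. An iterative connection is integrable if $\nabla_{\psi_1\psi_2}=\nabla_{\psi_1}\nabla_{\psi_2}$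 for all $\psi_1,\psi_2\in\mathrm{HD}_K(R)$. An (ordinary) connection is a $K$-linear map $\nabla^{(1)}:M\to\Omega_{R/K}\otimes_RM$ satisfying the Leibniz rule; it is integrable if $[\nabla^{(1)}_{\partial_1},\nabla^{(1)}_{\partial_2}]=\nabla^{(1)}_{[\partial_1,\partial_2]}$ for all $\partial_1,\partial_2\in\mathrm{Der}(R/K)$. *)

(* Defs.v *)
From HB Require Import structures.
From mathcomp Require Import all_boot all_order all_algebra all_field.
From mathcomp Require Import generic_quotient ring_quotient boolp zify.

Set Implicit Arguments.
Unset Strict Implicit.
Unset Printing Implicit Defensive.

Import GRing.Theory.
Local Open Scope ring_scope.
Local Open Scope quotient_scope.

Section CommutativeAlgebra.

Definition generated_by (A : comNzRingType) (I : {pred A}) n (x : 'I_n -> A) :=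
  forall y, y \in I <-> exists a : 'I_n -> A, y = \sum_i a i * x i.

(* [idealr_closed] requires 1 \notin I; the unit ideal is always principal, so
   it may be left out of the definition of a noetherian ring. *)
Definition noetherian (A : comNzRingType) :=
  forall I : {pred A}, idealr_closed I ->
  exists n (x : 'I_n -> A), generated_by I x.

Definition prime_ideal (A : comNzRingType) (P : {pred A}) :=
  idealr_closed P /\ prime_idealr_closed P.

Definition maximal_ideal (A : comNzRingType) (m : {pred A}) :=
  idealr_closed m /\
  forall I : {pred A}, idealr_closed I -> {subset m <= I} -> {subset I <= m}.

Definition prime_chain (A : comNzRingType) n :=
  exists c : nat -> {pred A},
    (forall i, (i <= n)%N -> prime_ideal (c i)) /\
    (forall i, (i < n)%N -> {subset c i <= c i.+1} /\
                            ~ {subset c i.+1 <= c i}).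

Definition krull_dim (A : comNzRingType) n :=
  prime_chain A n /\ ~ prime_chain A n.+1.

Definition regular_local (A : comNzRingType) :=
  noetherian A /\
  exists m : {pred A},
    [/\ maximal_ideal m,
        forall m' : {pred A}, maximal_ideal m' -> m' =i m &
        exists n, krull_dim A n /\ exists x : 'I_n -> A, generated_by m x].

(* [f] exhibits [A] as the localisation S^-1 B. *)
Definition localization (B A : comNzRingType) (S : {pred B})
    (f : {rmorphism B -> A}) :=
  [/\ mulr_closed S,
      forall s, s \in S -> exists u, f s * u = 1,
      forall a, exists b s, s \in S /\ a * f s = f b &
      forall b, f b = 0 -> exists s, s \in S /\ s * b = 0].

Definition regular_ring (R : comNzRingType) :=
  noetherian R /\
  forall P : {pred R}, prime_ideal P ->
  exists (A : comNzRingType) (f : {rmorphism R -> A}),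
    localization [predC P] f /\ regular_local A.

Definition fg_algebra (K : fieldType) (B : comAlgType K) :=
  exists n (g : 'I_n -> B), forall S : {pred B},
    subalg_closed S -> (forall i, g i \in S) -> forall b, b \in S.

Definition localization_of_fg_algebra (K : fieldType) (R : comAlgType K) :=
  exists (B : comAlgType K) (S : {pred B}) (f : {lrmorphism B -> R}),
    fg_algebra B /\ localization S f.

Definition finite_residue_field (K : fieldType) (R : comAlgType K)
    (m : {pred R}) :=
  exists (L : fieldExtType K) (p : {lrmorphism R -> L}),
    (forall y, exists x, p x = y) /\ (forall x, (x \in m) = (p x == 0)).

Definition fg_module (R : comNzRingType) (M : lmodType R) :=
  exists n (e : 'I_n -> M), forall x, exists a : 'I_n -> R,
    x = \sum_i a i *: e i.

Definition inverse_bijections (T U : Type) (A : T -> Prop) (B : U -> Prop)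
    (f : T -> U) (g : U -> T) :=
  [/\ forall x, A x -> B (f x), forall y, B y -> A (g y),
      forall x, A x -> g (f x) = x & forall y, B y -> f (g y) = y].

End CommutativeAlgebra.

(* [series V] is V[[T]]; with V graded, it also hosts the degree completion
   \prod_k V_k as the series whose k-th coefficient has degree k. *)
Definition series (V : Type) := nat -> V.

HB.instance Definition _ (V : Type) := gen_eqMixin (series V).
HB.instance Definition _ (V : Type) := gen_choiceMixin (series V).

Section SeriesZmod.
Variable V : zmodType.
Implicit Types f g h : series V.

Let sadd f g : series V := fun n => f n + g n.
Let sopp f : series V := fun n => - f n.

Let saddA : associative sadd.
Proof. by move=> f g h; apply: funext => n; exact: addrA. Qed.
Let saddC : commutative sadd.
Proof. by move=> f g; apply: funext => n; exact: addrC. Qed.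
Let sadd0 : left_id (fun=> 0 : V) sadd.
Proof. by move=> f; apply: funext => n; exact: add0r. Qed.
Let saddN : left_inverse (fun=> 0 : V) sopp sadd.
Proof. by move=> f; apply: funext => n; exact: addNr. Qed.

HB.instance Definition _ :=
  GRing.isZmodule.Build (series V) saddA saddC sadd0 saddN.

Lemma seriesD f g n : (f + g) n = f n + g n. Proof. by []. Qed.
Lemma series0 n : (0 : series V) n = 0. Proof. by []. Qed.
Lemma seriesN f n : (- f) n = - f n. Proof. by []. Qed.
Lemma series_sum I r (P : pred I) (F : I -> series V) n :
  (\sum_(i <- r | P i) F i) n = \sum_(i <- r | P i) F i n.
Proof. by elim/big_rec2: _ => // i y1 y2 _ <-. Qed.

End SeriesZmod.

(* The product of series attached to an action of A on V. *)
Definition sact (A : Type) (V : zmodType) (act : A -> V -> V)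
    (f : series A) (g : series V) : series V :=
  fun n => \sum_(i < n.+1) act (f i) (g (n - i)%N).

Definition smonomial (V : zmodType) (v : V) (k : nat) : series V :=
  fun n => if n == k then v else 0.

Section SeriesRing.
Variable A : comNzRingType.
Implicit Types f g h : series A.

Definition smul f g : series A := sact *%R f g.
Definition sone : series A := smonomial 1 0%N.

Let spoly m f : {poly A} := \poly_(i < m) f i.

Let smulE m f g n : (n < m)%N -> smul f g n = (spoly m f * spoly m g)`_n.
Proof.
move=> nm; rewrite coefM; apply: eq_bigr => i _; rewrite !coef_poly.
by rewrite (leq_ltn_trans _ nm) ?(leq_ltn_trans _ nm) ?leq_subr // -ltnS.
Qed.

Let spoly_mul m f g n : (n < m)%N ->
  (spoly m (smul f g))`_n = (spoly m f * spoly m g)`_n.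
Proof. by move=> nm; rewrite coef_poly nm (smulE _ _ nm). Qed.

Let smulA : associative smul.
Proof.
move=> f g h; apply: funext => n; rewrite !(@smulE n.+1) //.
transitivity (spoly n.+1 f * (spoly n.+1 g * spoly n.+1 h))`_n.
  rewrite 2!coefM; apply: eq_bigr => i _; congr (_ * _).
  by apply: spoly_mul; rewrite ltnS leq_subr.
rewrite mulrA 2!coefM; apply: eq_bigr => i _; congr (_ * _).
by rewrite spoly_mul.
Qed.

Let smulC : commutative smul.
Proof. by move=> f g; apply: funext => n; rewrite !(@smulE n.+1) // mulrC. Qed.

Let smul1 : left_id sone smul.
Proof.
move=> f; apply: funext => n; rewrite /smul /sact big_ord_recl /= big1.
  by rewrite /sone /smonomial mul1r addr0 subn0.
by move=> i _; rewrite /sone /smonomial mul0r.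
Qed.

Let smulDl : left_distributive smul +%R.
Proof.
move=> f g h; apply: funext => n; rewrite /smul /sact seriesD -big_split /=.
by apply: eq_bigr => i _; rewrite mulrDl.
Qed.

Let sone_neq0 : sone != 0.
Proof.
apply/eqP => /(congr1 (fun f : series A => f 0%N)) /eqP.
by rewrite /sone /smonomial /= series0 oner_eq0.
Qed.

HB.instance Definition _ :=
  GRing.Zmodule_isComNzRing.Build (series A) smulA smulC smul1 smulDl sone_neq0.

Lemma seriesM f g n : (f * g) n = \sum_(i < n.+1) f i * g (n - i)%N.
Proof. by []. Qed.
Lemma series1 n : (1 : series A) n = (n == 0)%N%:R.
Proof. by rewrite /GRing.one /= /sone /smonomial; case: eqP. Qed.

Lemma smonomialM (a b : A) i j :
  (smonomial a i : series A) * smonomial b j = smonomial (a * b) (i + j)%N.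
Proof.
apply: funext => n; rewrite seriesM /smonomial.
case: (ltnP n i) => [ni|lein].
  rewrite big1 => [|k _]; last by rewrite ltn_eqF ?mul0r // (leq_trans (ltn_ord k)).
  by rewrite ltn_eqF // (leq_trans ni) ?leq_addr.
have ni : (i < n.+1)%N by [].
rewrite (bigD1 (Ordinal ni)) //= eqxx big1 => [|k]; last first.
  by rewrite -val_eqE /= => /negPf ->; rewrite mul0r.
by rewrite addr0 -(eqn_add2l i) subnKC //; case: eqP => // _; rewrite mulr0.
Qed.

End SeriesRing.

Lemma sactA (A : comNzRingType) (V : zmodType) (act : A -> V -> V) :
  (forall v, {morph act^~ v : a b / a + b}) ->
  (forall a, {morph act a : v w / v + w}) ->
  (forall a b v, act (a * b) v = act a (act b v)) ->
  forall (f g : series A) h, sact act (f * g) h = sact act f (sact act g h).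
Proof.
move=> actDl actDr actA f g h; apply: funext => n.
have act0l v : act 0 v = 0 by apply: (addrI (act 0 v)); rewrite -actDl !addr0.
have act0r a : act a 0 = 0 by apply: (addrI (act a 0)); rewrite -actDr !addr0.
have act_suml I r (P : pred I) (F : I -> A) v :
    act (\sum_(i <- r | P i) F i) v = \sum_(i <- r | P i) act (F i) v.
  exact: (big_morph (act^~ v) (actDl v) (act0l v)).
have act_sumr I r (P : pred I) (F : I -> V) a :
    act a (\sum_(i <- r | P i) F i) = \sum_(i <- r | P i) act a (F i).
  exact: (big_morph (act a) (actDr a) (act0r a)).
pose G a i := act (f a) (act (g (i - a)%N) (h (n - i)%N)).
transitivity (\sum_(0 <= i < n.+1) \sum_(0 <= a < n.+1 | (a <= i)%N) G a i).
  rewrite [RHS]big_mkord; apply: eq_bigr => i _; rewrite seriesM act_suml.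
  rewrite -(big_mkord xpredT (fun a => act (f a * g (i - a)%N) (h (n - i)%N))).
  rewrite (big_nat_widen 0 i.+1 n.+1) //=.
  by apply: eq_bigr => a _; rewrite actA.
rewrite (exchange_big_dep_nat xpredT) //= [LHS]big_mkord.
apply: eq_bigr => a _; rewrite act_sumr.
have an : (a <= n)%N by rewrite -ltnS.
transitivity (\sum_(a <= i < n.+1) G a i).
  rewrite (@big_cat_nat _ _ _ a) ?(leq_trans an) //= big_nat_cond big1 ?add0r.
    by rewrite big_nat_cond [RHS]big_nat; apply: eq_bigl => i; lia.
  by move=> i; lia.
rewrite -{1}[a : nat]add0n big_addn subSn // big_mkord; apply: eq_bigr => b _.
by rewrite /G addnK; congr (act _ (act _ (h _))); lia.
Qed.

(* [sext F] is F[[T]], and [scomp F G] is F[[T]] \o G. *)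
Definition sext (V : zmodType) (F : V -> series V) (g : series V) : series V :=
  fun n => \sum_(i < n.+1) F (g i) (n - i)%N.

Definition scomp (V : zmodType) (F G : V -> series V) (x : V) : series V :=
  sext F (G x).

Section Derivations.
Variables (K : fieldType) (R : comAlgType K).

Definition derivation (N : lmodType R) (d : R -> N) :=
  [/\ {morph d : r s / r + s},
      forall (a : K) r, d (a *: r) = a%:A *: d r &
      forall r s, d (r * s) = r *: d s + s *: d r].

Definition universal_derivation (W : lmodType R) (d : R -> W) :=
  derivation d /\
  forall (N : lmodType R) (e : R -> N), derivation e ->
  exists! f : W -> N, linear f /\ forall r, f (d r) = e r.

Definition Der (d : R -> R) := derivation (d : R -> R^o).

Definition Der_over (d : R -> R) (M : lmodType R) (dM : M -> M) :=
  {morph dM : x y / x + y} /\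
  forall r m, dM (r *: m) = d r *: m + r *: dM m.

Definition bracket (d1 d2 : R -> R) (r : R) := d1 (d2 r) - d2 (d1 r).

Definition HD (psi : R -> series R) :=
  [/\ zmod_morphism psi, monoid_morphism psi,
      forall (a : K) r k, psi (a *: r) k = a *: psi r k &
      forall r, psi r 0%N = r].

Definition ID (phi : R -> series R) :=
  HD phi /\
  forall i j r, phi (phi r j) i = phi r (i + j)%N *+ 'C(i + j, i).

Definition ID_over (M : lmodType R) (phi : R -> series R)
    (Phi : M -> series M) :=
  [/\ zmod_morphism Phi,
      forall m, Phi m 0%N = m,
      forall r m, Phi (r *: m) = sact *:%R (phi r) (Phi m) &
      forall i j m, Phi (Phi m j) i = Phi m (i + j)%N *+ 'C(i + j, i)].

Definition exp_Der (d : R -> R) (r : R) : series R :=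
  fun n => (n`!%:R^-1 : K) *: iter n d r.

Definition exp_Der_over (M : lmodType R) (dM : M -> M) (m : M) : series M :=
  fun n => (n`!%:R^-1 : K)%:A *: iter n dM m.

End Derivations.

Section Tensor.
Variables (R : comNzRingType) (N M : lmodType R).

Inductive tterm : Type :=
| T0 | Tpure of N & M | Tadd of tterm & tterm | Topp of tterm.

Inductive teqv : tterm -> tterm -> Prop :=
| teqv_refl t : teqv t t
| teqv_sym t u : teqv t u -> teqv u t
| teqv_trans t u v : teqv t u -> teqv u v -> teqv t v
| teqv_add t t' u u' : teqv t t' -> teqv u u' -> teqv (Tadd t u) (Tadd t' u')
| teqv_opp t t' : teqv t t' -> teqv (Topp t) (Topp t')
| teqv_addA t u v : teqv (Tadd t (Tadd u v)) (Tadd (Tadd t u) v)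
| teqv_addC t u : teqv (Tadd t u) (Tadd u t)
| teqv_add0 t : teqv (Tadd T0 t) t
| teqv_addN t : teqv (Tadd (Topp t) t) T0
| teqv_Dl x y m : teqv (Tpure (x + y) m) (Tadd (Tpure x m) (Tpure y m))
| teqv_Dr x m n : teqv (Tpure x (m + n)) (Tadd (Tpure x m) (Tpure x n))
| teqv_bal r x m : teqv (Tpure (r *: x) m) (Tpure x (r *: m)).

HB.instance Definition _ := gen_eqMixin tterm.
HB.instance Definition _ := gen_choiceMixin tterm.

Definition teqvb : rel tterm := fun t u => `[< teqv t u >].

Let teqvb_refl : reflexive teqvb.
Proof. by move=> t; apply/asboolP; exact: teqv_refl. Qed.
Let teqvb_sym : symmetric teqvb.
Proof. by move=> t u; apply: asbool_equiv_eq; split; exact: teqv_sym. Qed.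
Let teqvb_trans : transitive teqvb.
Proof.
move=> u t v /asboolP tu /asboolP uv.
by apply/asboolP; exact: teqv_trans tu uv.
Qed.

Canonical teqv_equiv := EquivRel teqvb teqvb_refl teqvb_sym teqvb_trans.

Definition tensor := {eq_quot teqvb}.

HB.instance Definition _ := Choice.on tensor.
HB.instance Definition _ := EqQuotient.on tensor.

Definition tcls (t : tterm) : tensor := \pi_tensor t.

Lemma tclsP t u : tcls t = tcls u <-> teqv t u.
Proof.
by split=> [/eqquotP/asboolP //|tu]; apply/eqquotP/asboolP.
Qed.

Lemma tclsK (x : tensor) : tcls (repr x) = x. Proof. exact: reprK. Qed.
Lemma repr_tcls t : teqv (repr (tcls t)) t.
Proof. by apply/tclsP; rewrite tclsK. Qed.
Lemma tcls_ind (P : tensor -> Prop) : (forall t, P (tcls t)) -> forall x, P x.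
Proof. by move=> Pt x; rewrite -(tclsK x). Qed.

Let tadd (x y : tensor) : tensor := tcls (Tadd (repr x) (repr y)).
Let topp (x : tensor) : tensor := tcls (Topp (repr x)).

Let taddE t u : tadd (tcls t) (tcls u) = tcls (Tadd t u).
Proof. by apply/tclsP; apply: teqv_add; exact: repr_tcls. Qed.
Let toppE t : topp (tcls t) = tcls (Topp t).
Proof. by apply/tclsP; apply: teqv_opp; exact: repr_tcls. Qed.

Let taddA : associative tadd.
Proof.
elim/tcls_ind => t; elim/tcls_ind => u; elim/tcls_ind => v.
by rewrite !taddE; apply/tclsP; exact: teqv_addA.
Qed.
Let taddC : commutative tadd.
Proof.
elim/tcls_ind => t; elim/tcls_ind => u.
by rewrite !taddE; apply/tclsP; exact: teqv_addC.
Qed.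
Let tadd0 : left_id (tcls T0) tadd.
Proof. by elim/tcls_ind => t; rewrite taddE; apply/tclsP/teqv_add0. Qed.
Let taddN : left_inverse (tcls T0) topp tadd.
Proof.
by elim/tcls_ind => t; rewrite toppE taddE; apply/tclsP/teqv_addN.
Qed.

HB.instance Definition _ :=
  GRing.isZmodule.Build tensor taddA taddC tadd0 taddN.

Definition tens (x : N) (m : M) : tensor := tcls (Tpure x m).

Lemma tcls0 : tcls T0 = 0. Proof. by []. Qed.
Lemma tclsD t u : tcls (Tadd t u) = tcls t + tcls u.
Proof. by rewrite -taddE. Qed.
Lemma tclsN t : tcls (Topp t) = - tcls t.
Proof. by rewrite -toppE. Qed.
Lemma tensDl x y m : tens (x + y) m = tens x m + tens y m.
Proof. by rewrite /tens -tclsD; apply/tclsP/teqv_Dl. Qed.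
Lemma tensDr x m n : tens x (m + n) = tens x m + tens x n.
Proof. by rewrite /tens -tclsD; apply/tclsP/teqv_Dr. Qed.
Lemma tens_bal r x m : tens (r *: x) m = tens x (r *: m).
Proof. by apply/tclsP/teqv_bal. Qed.

Section Extension.
Variables (V : zmodType) (f : N -> M -> V).

Fixpoint teval (t : tterm) : V :=
  match t with
  | T0 => 0
  | Tpure x m => f x m
  | Tadd t u => teval t + teval u
  | Topp t => - teval t
  end.

(* The additive map with x (x) m |-> f x m, when f is biadditive and
   R-balanced. *)
Definition tensor_ext (x : tensor) : V := teval (repr x).

Definition balanced :=
  [/\ forall x y m, f (x + y) m = f x m + f y m,
      forall x m n, f x (m + n) = f x m + f x n &
      forall r x m, f (r *: x) m = f x (r *: m)].

Hypothesis fbal : balanced.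

Lemma teval_teqv t u : teqv t u -> teval t = teval u.
Proof.
case: fbal => fDl fDr fb; elim=> //=.
- by move=> ? ? ? _ -> _ ->.
- by move=> ? ? ? ? _ -> _ ->.
- by move=> ? ? _ ->.
- by move=> *; rewrite addrA.
- by move=> *; rewrite addrC.
- by move=> *; rewrite add0r.
- by move=> *; rewrite addNr.
Qed.

Lemma tensor_ext_cls t : tensor_ext (tcls t) = teval t.
Proof. exact: teval_teqv (repr_tcls t). Qed.

Lemma tensor_ext_tens x m : tensor_ext (tens x m) = f x m.
Proof. exact: tensor_ext_cls. Qed.

Lemma tensor_extD : {morph tensor_ext : x y / x + y}.
Proof.
elim/tcls_ind => t; elim/tcls_ind => u.
by rewrite -tclsD !tensor_ext_cls.
Qed.

End Extension.

Let tscal (r : R) : tensor -> tensor := tensor_ext (fun x m => tens (r *: x) m).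

Let tscal_bal r : balanced (fun x m => tens (r *: x) m).
Proof.
split=> [x y m|x m n|s x m]; first by rewrite scalerDr tensDl.
  exact: tensDr.
by rewrite scalerA mulrC -scalerA tens_bal.
Qed.

Lemma tensor_ind (P : tensor -> Prop) :
  P 0 -> (forall x m, P (tens x m)) -> (forall x y, P x -> P y -> P (x + y)) ->
  forall x, P x.
Proof.
move=> P0 Pt PD; elim/tcls_ind => t.
suff [] : P (tcls t) /\ P (- tcls t) by [].
elim: t => [|x m|t [Pt1 Pt2] u [Pu1 Pu2]|t [Pt1 Pt2]].
- by rewrite tcls0 oppr0.
- split; first exact: Pt.
  suff <- : tens (- x) m = - tcls (Tpure x m) by exact: Pt.
  apply/eqP; rewrite -addr_eq0 -tensDl addNr; apply/eqP.
  by apply: (addrI (tens 0 m)); rewrite -tensDl !addr0.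
- by rewrite tclsD opprD; split; exact: PD.
- by rewrite tclsN opprK.
Qed.

Let tscalE r x m : tscal r (tens x m) = tens (r *: x) m.
Proof. exact: tensor_ext_tens (tscal_bal r) _ _. Qed.
Let tscalDr : right_distributive tscal +%R.
Proof. by move=> r; exact: tensor_extD (tscal_bal r). Qed.
Let tscal0 r : tscal r (0 : tensor) = 0.
Proof. by apply: (addrI (tscal r 0)); rewrite -tscalDr !addr0. Qed.
Let tscalA r s x : tscal r (tscal s x) = tscal (r * s) x.
Proof.
elim/tensor_ind: x => [|x m|x y IHx IHy]; first by rewrite !tscal0.
  by rewrite !tscalE scalerA.
by rewrite !tscalDr IHx IHy.
Qed.
Let tscal1 : left_id 1 tscal.
Proof.
elim/tensor_ind => [|x m|x y IHx IHy]; first exact: tscal0.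
  by rewrite tscalE scale1r.
by rewrite tscalDr IHx IHy.
Qed.
Let tscalDl x : {morph tscal^~ x : r s / r + s}.
Proof.
move=> r s; elim/tensor_ind: x => [|x m|x y IHx IHy].
- by rewrite !tscal0 addr0.
- by rewrite !tscalE scalerDl tensDl.
- by rewrite !tscalDr IHx IHy addrACA.
Qed.

HB.instance Definition _ :=
  GRing.Zmodule_isLmodule.Build R tensor tscalA tscal1 tscalDr tscalDl.

Lemma tensZ r x m : r *: tens x m = tens (r *: x) m.
Proof. exact: tscalE. Qed.

End Tensor.

Section Kaehler.
Variables (K : fieldType) (R : comAlgType K).

Inductive kterm : Type :=
| K0 | Kd of R | Kadd of kterm & kterm | Kopp of kterm | Kscale of R & kterm.

Inductive keqv : kterm -> kterm -> Prop :=
| keqv_refl t : keqv t t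
| keqv_sym t u : keqv t u -> keqv u t
| keqv_trans t u v : keqv t u -> keqv u v -> keqv t v
| keqv_add t t' u u' : keqv t t' -> keqv u u' -> keqv (Kadd t u) (Kadd t' u')
| keqv_opp t t' : keqv t t' -> keqv (Kopp t) (Kopp t')
| keqv_scale r t t' : keqv t t' -> keqv (Kscale r t) (Kscale r t')
| keqv_addA t u v : keqv (Kadd t (Kadd u v)) (Kadd (Kadd t u) v)
| keqv_addC t u : keqv (Kadd t u) (Kadd u t)
| keqv_add0 t : keqv (Kadd K0 t) t
| keqv_addN t : keqv (Kadd (Kopp t) t) K0
| keqv_scaleA r s t : keqv (Kscale r (Kscale s t)) (Kscale (r * s) t)
| keqv_scale1 t : keqv (Kscale 1 t) t
| keqv_scaleDr r t u :
    keqv (Kscale r (Kadd t u)) (Kadd (Kscale r t) (Kscale r u))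
| keqv_scaleDl r s t : keqv (Kscale (r + s) t) (Kadd (Kscale r t) (Kscale s t))
| keqv_dD r s : keqv (Kd (r + s)) (Kadd (Kd r) (Kd s))
| keqv_dC (a : K) : keqv (Kd a%:A) K0
| keqv_dM r s : keqv (Kd (r * s)) (Kadd (Kscale r (Kd s)) (Kscale s (Kd r))).

HB.instance Definition _ := gen_eqMixin kterm.
HB.instance Definition _ := gen_choiceMixin kterm.

Definition keqvb : rel kterm := fun t u => `[< keqv t u >].

Let keqvb_refl : reflexive keqvb.
Proof. by move=> t; apply/asboolP; exact: keqv_refl. Qed.
Let keqvb_sym : symmetric keqvb.
Proof. by move=> t u; apply: asbool_equiv_eq; split; exact: keqv_sym. Qed.
Let keqvb_trans : transitive keqvb.
Proof.
move=> u t v /asboolP tu /asboolP uv.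
by apply/asboolP; exact: keqv_trans tu uv.
Qed.

Canonical keqv_equiv := EquivRel keqvb keqvb_refl keqvb_sym keqvb_trans.

Definition kaehler := {eq_quot keqvb}.

HB.instance Definition _ := Choice.on kaehler.
HB.instance Definition _ := EqQuotient.on kaehler.

Definition kcls (t : kterm) : kaehler := \pi_kaehler t.

Lemma kclsP t u : kcls t = kcls u <-> keqv t u.
Proof.
by split=> [/eqquotP/asboolP //|tu]; apply/eqquotP/asboolP.
Qed.

Lemma kclsK (x : kaehler) : kcls (repr x) = x. Proof. exact: reprK. Qed.
Lemma repr_kcls t : keqv (repr (kcls t)) t.
Proof. by apply/kclsP; rewrite kclsK. Qed.
Lemma kcls_ind (P : kaehler -> Prop) : (forall t, P (kcls t)) -> forall x, P x.
Proof. by move=> Pt x; rewrite -(kclsK x). Qed.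

Let kadd (x y : kaehler) : kaehler := kcls (Kadd (repr x) (repr y)).
Let kopp (x : kaehler) : kaehler := kcls (Kopp (repr x)).
Let kscal r (x : kaehler) : kaehler := kcls (Kscale r (repr x)).

Let kaddE t u : kadd (kcls t) (kcls u) = kcls (Kadd t u).
Proof. by apply/kclsP; apply: keqv_add; exact: repr_kcls. Qed.
Let koppE t : kopp (kcls t) = kcls (Kopp t).
Proof. by apply/kclsP; apply: keqv_opp; exact: repr_kcls. Qed.
Let kscalE r t : kscal r (kcls t) = kcls (Kscale r t).
Proof. by apply/kclsP; apply: keqv_scale; exact: repr_kcls. Qed.

Let kaddA : associative kadd.
Proof.
elim/kcls_ind => t; elim/kcls_ind => u; elim/kcls_ind => v.
by rewrite !kaddE; apply/kclsP; exact: keqv_addA.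
Qed.
Let kaddC : commutative kadd.
Proof.
elim/kcls_ind => t; elim/kcls_ind => u.
by rewrite !kaddE; apply/kclsP; exact: keqv_addC.
Qed.
Let kadd0 : left_id (kcls K0) kadd.
Proof. by elim/kcls_ind => t; rewrite kaddE; apply/kclsP/keqv_add0. Qed.
Let kaddN : left_inverse (kcls K0) kopp kadd.
Proof.
by elim/kcls_ind => t; rewrite koppE kaddE; apply/kclsP/keqv_addN.
Qed.

HB.instance Definition _ :=
  GRing.isZmodule.Build kaehler kaddA kaddC kadd0 kaddN.

Let kscalA r s x : kscal r (kscal s x) = kscal (r * s) x.
Proof.
by elim/kcls_ind: x => t; rewrite !kscalE; apply/kclsP/keqv_scaleA.
Qed.
Let kscal1 : left_id 1 kscal.
Proof. by elim/kcls_ind => t; rewrite kscalE; apply/kclsP/keqv_scale1. Qed.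
Let kscalDr : right_distributive kscal +%R.
Proof.
move=> r; elim/kcls_ind => t; elim/kcls_ind => u.
rewrite -[_ + _]/(kadd _ _) -[RHS]/(kadd _ _) kaddE !kscalE kaddE.
by apply/kclsP/keqv_scaleDr.
Qed.
Let kscalDl x : {morph kscal^~ x : r s / r + s}.
Proof.
move=> r s; elim/kcls_ind: x => t.
by rewrite -[RHS]/(kadd _ _) !kscalE kaddE; apply/kclsP/keqv_scaleDl.
Qed.

HB.instance Definition _ :=
  GRing.Zmodule_isLmodule.Build R kaehler kscalA kscal1 kscalDr kscalDl.

Definition kd (r : R) : kaehler := kcls (Kd r).

Lemma kcls0 : kcls K0 = 0. Proof. by []. Qed.
Lemma kclsD t u : kcls (Kadd t u) = kcls t + kcls u.
Proof. by rewrite -kaddE. Qed.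
Lemma kclsN t : kcls (Kopp t) = - kcls t.
Proof. by rewrite -koppE. Qed.
Lemma kclsZ r t : kcls (Kscale r t) = r *: kcls t.
Proof. by rewrite -kscalE. Qed.

Lemma kd_derivation : derivation kd.
Proof.
have kdM r s : kd (r * s) = r *: kd s + s *: kd r.
  by rewrite /kd -!kclsZ -kclsD; apply/kclsP/keqv_dM.
split=> // [r s|a r]; first by rewrite /kd -kclsD; apply/kclsP/keqv_dD.
rewrite -(mulr_algl a r) kdM -[X in _ + X](_ : 0 = _) ?addr0 //.
by rewrite /kd (_ : kcls (Kd a%:A) = 0) ?scaler0 //; apply/kclsP/keqv_dC.
Qed.

Section Extension.
Variables (N : lmodType R) (d : R -> N).

Fixpoint keval (t : kterm) : N :=
  match t with
  | K0 => 0
  | Kd r => d r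
  | Kadd t u => keval t + keval u
  | Kopp t => - keval t
  | Kscale r t => r *: keval t
  end.

(* The R-linear map with dr |-> d r, when d is a derivation. *)
Definition kaehler_ext (x : kaehler) : N := keval (repr x).

Hypothesis dder : derivation d.

Lemma keval_keqv t u : keqv t u -> keval t = keval u.
Proof.
case: dder => dD dZ dM; elim=> //=.
- by move=> ? ? ? _ -> _ ->.
- by move=> ? ? ? ? _ -> _ ->.
- by move=> ? ? _ ->.
- by move=> ? ? ? _ ->.
- by move=> *; rewrite addrA.
- by move=> *; rewrite addrC.
- by move=> *; rewrite add0r.
- by move=> *; rewrite addNr.
- by move=> *; rewrite scalerA.
- by move=> *; rewrite scale1r.
- by move=> *; rewrite scalerDr.
- by move=> *; rewrite scalerDl.
- move=> a; have d1 : d 1 = 0.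
    have := dM 1 1; rewrite mulr1 !scale1r => /eqP.
    by rewrite addrC -subr_eq subrr => /eqP <-.
  by rewrite dZ d1 scaler0.
Qed.

Lemma kaehler_ext_cls t : kaehler_ext (kcls t) = keval t.
Proof. exact: keval_keqv (repr_kcls t). Qed.

Lemma kaehler_ext_kd r : kaehler_ext (kd r) = d r.
Proof. exact: kaehler_ext_cls. Qed.

Lemma kaehler_ext_linear : linear kaehler_ext.
Proof.
move=> a; elim/kcls_ind => t; elim/kcls_ind => u.
by rewrite -kclsZ -kclsD !kaehler_ext_cls.
Qed.

End Extension.
End Kaehler.

Arguments kaehler {K} R.

Section HigherDifferentials.
Variables (K : fieldType) (R : comAlgType K).

(* [OD k r] stands for d^(k.+1) r. *)
Inductive oterm : Type :=
| OC of R | OD of nat & R | Oadd of oterm & oterm | Oopp of oterm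
| Omul of oterm & oterm.

Definition Od k r := if k is k'.+1 then OD k' r else OC r.

Definition Oleibniz k r s :=
  foldr Oadd (OC 0) [seq Omul (Od i r) (Od (k - i) s) | i <- iota 0 k.+1].

Inductive oeqv : oterm -> oterm -> Prop :=
| oeqv_refl t : oeqv t t
| oeqv_sym t u : oeqv t u -> oeqv u t
| oeqv_trans t u v : oeqv t u -> oeqv u v -> oeqv t v
| oeqv_add t t' u u' : oeqv t t' -> oeqv u u' -> oeqv (Oadd t u) (Oadd t' u')
| oeqv_opp t t' : oeqv t t' -> oeqv (Oopp t) (Oopp t')
| oeqv_mul t t' u u' : oeqv t t' -> oeqv u u' -> oeqv (Omul t u) (Omul t' u')
| oeqv_addA t u v : oeqv (Oadd t (Oadd u v)) (Oadd (Oadd t u) v)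
| oeqv_addC t u : oeqv (Oadd t u) (Oadd u t)
| oeqv_add0 t : oeqv (Oadd (OC 0) t) t
| oeqv_addN t : oeqv (Oadd (Oopp t) t) (OC 0)
| oeqv_mulA t u v : oeqv (Omul t (Omul u v)) (Omul (Omul t u) v)
| oeqv_mulC t u : oeqv (Omul t u) (Omul u t)
| oeqv_mul1 t : oeqv (Omul (OC 1) t) t
| oeqv_mulDl t u v : oeqv (Omul (Oadd t u) v) (Oadd (Omul t v) (Omul u v))
| oeqv_CD r s : oeqv (OC (r + s)) (Oadd (OC r) (OC s))
| oeqv_CM r s : oeqv (OC (r * s)) (Omul (OC r) (OC s))
| oeqv_dD k r s : oeqv (OD k (r + s)) (Oadd (OD k r) (OD k s))
| oeqv_dC k (a : K) : oeqv (OD k a%:A) (OC 0)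
| oeqv_dM k r s : oeqv (OD k (r * s)) (Oleibniz k.+1 r s).

HB.instance Definition _ := gen_eqMixin oterm.
HB.instance Definition _ := gen_choiceMixin oterm.

Definition oeqvb : rel oterm := fun t u => `[< oeqv t u >].

Let oeqvb_refl : reflexive oeqvb.
Proof. by move=> t; apply/asboolP; exact: oeqv_refl. Qed.
Let oeqvb_sym : symmetric oeqvb.
Proof. by move=> t u; apply: asbool_equiv_eq; split; exact: oeqv_sym. Qed.
Let oeqvb_trans : transitive oeqvb.
Proof.
move=> u t v /asboolP tu /asboolP uv.
by apply/asboolP; exact: oeqv_trans tu uv.
Qed.

Canonical oeqv_equiv := EquivRel oeqvb oeqvb_refl oeqvb_sym oeqvb_trans.

(* The graded algebra before completion: the direct sum of its degree-k parts.
   Its completion is the set of w : series Omega with [homog k (w k)]. *)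
Definition Omega := {eq_quot oeqvb}.

HB.instance Definition _ := Choice.on Omega.
HB.instance Definition _ := EqQuotient.on Omega.

Definition ocls (t : oterm) : Omega := \pi_Omega t.

Lemma oclsP t u : ocls t = ocls u <-> oeqv t u.
Proof.
by split=> [/eqquotP/asboolP //|tu]; apply/eqquotP/asboolP.
Qed.

Lemma oclsK (x : Omega) : ocls (repr x) = x. Proof. exact: reprK. Qed.
Lemma repr_ocls t : oeqv (repr (ocls t)) t.
Proof. by apply/oclsP; rewrite oclsK. Qed.
Lemma ocls_ind (P : Omega -> Prop) : (forall t, P (ocls t)) -> forall x, P x.
Proof. by move=> Pt x; rewrite -(oclsK x). Qed.

Section Evaluation.
Variables (B : comNzRingType) (f : R -> B) (g : nat -> R -> B).

Fixpoint oeval (t : oterm) : B :=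
  match t with
  | OC r => f r
  | OD k r => g k.+1 r
  | Oadd t u => oeval t + oeval u
  | Oopp t => - oeval t
  | Omul t u => oeval t * oeval u
  end.

(* The ring homomorphism with r |-> f r and d^(k) r |-> g k r, provided these
   data are [odata] (compatible with the relations). *)
Definition Omega_ext (w : Omega) : B := oeval (repr w).

Definition odata :=
  [/\ zmod_morphism f /\ monoid_morphism f,
      g 0%N =1 f,
      forall k, zmod_morphism (g k),
      forall k (a : K), g k.+1 a%:A = 0 &
      forall k r s, g k (r * s) = \sum_(i < k.+1) g i r * g (k - i)%N s].

Hypothesis fg : odata.

Lemma oeval_oeqv t u : oeqv t u -> oeval t = oeval u.
Proof.
case: fg => [[fB [f1 fM]] g0 gB gC gM].
have f0 : f 0 = 0 by rewrite -(subrr 0) fB subrr.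
have addm (h : R -> B) : zmod_morphism h -> {morph h : x y / x + y}.
  move=> hB x y; have h0 : h 0 = 0 by rewrite -(subrr 0) hB subrr.
  by rewrite -{1}[y]opprK hB -(sub0r y) hB h0 sub0r opprK.
have oeval_leibniz k r s :
    \sum_(i < k.+1) g i r * g (k - i)%N s = oeval (Oleibniz k r s).
  have evd j x : oeval (Od j x) = g j x by case: j => //=; rewrite g0.
  rewrite -(big_mkord xpredT (fun i => g i r * g (k - i)%N s)) /index_iota subn0.
  rewrite /Oleibniz; elim: (iota _ _) => [|i l IH] /=; first by rewrite big_nil.
  by rewrite big_cons IH !evd.
elim=> //=.
- by move=> ? ? ? _ -> _ ->.
- by move=> ? ? ? ? _ -> _ ->.
- by move=> ? ? _ ->.
- by move=> ? ? ? ? _ -> _ ->.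
- by move=> *; rewrite addrA.
- by move=> *; rewrite addrC.
- by move=> *; rewrite f0 add0r.
- by move=> *; rewrite addNr f0.
- by move=> *; rewrite mulrA.
- by move=> *; rewrite mulrC.
- by move=> *; rewrite f1 mul1r.
- by move=> *; rewrite mulrDl.
- by move=> r s; exact: addm.
- by move=> k r s; exact: addm.
- by move=> k a; rewrite gC f0.
move=> k r s; rewrite gM; exact: (oeval_leibniz k.+1).
Qed.

Lemma Omega_ext_cls t : Omega_ext (ocls t) = oeval t.
Proof. exact: oeval_oeqv (repr_ocls t). Qed.

End Evaluation.

Let oadd (x y : Omega) : Omega := ocls (Oadd (repr x) (repr y)).
Let oopp (x : Omega) : Omega := ocls (Oopp (repr x)).
Let omul (x y : Omega) : Omega := ocls (Omul (repr x) (repr y)).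

Let oaddE t u : oadd (ocls t) (ocls u) = ocls (Oadd t u).
Proof. by apply/oclsP; apply: oeqv_add; exact: repr_ocls. Qed.
Let ooppE t : oopp (ocls t) = ocls (Oopp t).
Proof. by apply/oclsP; apply: oeqv_opp; exact: repr_ocls. Qed.
Let omulE t u : omul (ocls t) (ocls u) = ocls (Omul t u).
Proof. by apply/oclsP; apply: oeqv_mul; exact: repr_ocls. Qed.

Let oaddA : associative oadd.
Proof.
elim/ocls_ind => t; elim/ocls_ind => u; elim/ocls_ind => v.
by rewrite !oaddE; apply/oclsP; exact: oeqv_addA.
Qed.
Let oaddC : commutative oadd.
Proof.
elim/ocls_ind => t; elim/ocls_ind => u.
by rewrite !oaddE; apply/oclsP; exact: oeqv_addC.
Qed.
Let oadd0 : left_id (ocls (OC 0)) oadd.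
Proof. by elim/ocls_ind => t; rewrite oaddE; apply/oclsP/oeqv_add0. Qed.
Let oaddN : left_inverse (ocls (OC 0)) oopp oadd.
Proof.
by elim/ocls_ind => t; rewrite ooppE oaddE; apply/oclsP/oeqv_addN.
Qed.

HB.instance Definition _ :=
  GRing.isZmodule.Build Omega oaddA oaddC oadd0 oaddN.

Let omulA : associative omul.
Proof.
elim/ocls_ind => t; elim/ocls_ind => u; elim/ocls_ind => v.
by rewrite !omulE; apply/oclsP; exact: oeqv_mulA.
Qed.
Let omulC : commutative omul.
Proof.
elim/ocls_ind => t; elim/ocls_ind => u.
by rewrite !omulE; apply/oclsP; exact: oeqv_mulC.
Qed.
Let omul1 : left_id (ocls (OC 1)) omul.
Proof. by elim/ocls_ind => t; rewrite omulE; apply/oclsP/oeqv_mul1. Qed.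
Let omulDl : left_distributive omul +%R.
Proof.
elim/ocls_ind => t; elim/ocls_ind => u; elim/ocls_ind => v.
rewrite -[_ + _]/(oadd _ _) -[RHS]/(oadd _ _) oaddE !omulE oaddE.
by apply/oclsP; exact: oeqv_mulDl.
Qed.

Let augmentation_data : odata id (fun k r => if k is 0 then r else 0).
Proof.
split=> //; first by move=> [|k] // x y; rewrite subr0.
move=> [|k] r s; first by rewrite big_ord1.
by rewrite big_ord_recl /= big1 ?mulr0 ?addr0 // => i _; rewrite mul0r.
Qed.

Let oone_neq0 : ocls (OC 1) != 0.
Proof.
apply/eqP => /oclsP /(oeval_oeqv augmentation_data) /eqP.
by rewrite /= oner_eq0.
Qed.

HB.instance Definition _ :=
  GRing.Zmodule_isComNzRing.Build Omega omulA omulC omul1 omulDl oone_neq0.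

Lemma oclsD t u : ocls (Oadd t u) = ocls t + ocls u.
Proof. by rewrite -oaddE. Qed.
Lemma oclsN t : ocls (Oopp t) = - ocls t.
Proof. by rewrite -ooppE. Qed.
Lemma oclsM t u : ocls (Omul t u) = ocls t * ocls u.
Proof. by rewrite -omulE. Qed.

Section EvaluationMorphism.
Variables (B : comNzRingType) (f : R -> B) (g : nat -> R -> B).
Hypothesis fg : odata f g.

Lemma Omega_extD : {morph Omega_ext f g : x y / x + y}.
Proof.
elim/ocls_ind => t; elim/ocls_ind => u.
by rewrite -oclsD !Omega_ext_cls.
Qed.

Lemma Omega_extM : {morph Omega_ext f g : x y / x * y}.
Proof.
elim/ocls_ind => t; elim/ocls_ind => u.
by rewrite -oclsM !Omega_ext_cls.
Qed.

Lemma Omega_ext1 : Omega_ext f g 1 = 1.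
Proof. by rewrite Omega_ext_cls //=; case: fg => [[_ []]]. Qed.

End EvaluationMorphism.

Let oscal r (x : Omega) : Omega := ocls (OC r) * x.

Let oscalA r s x : oscal r (oscal s x) = oscal (r * s) x.
Proof.
rewrite /oscal mulrA -oclsM; congr (_ * _); apply/oclsP.
exact/oeqv_sym/oeqv_CM.
Qed.
Let oscal1 : left_id 1 oscal. Proof. by move=> x; exact: mul1r. Qed.
Let oscalDr : right_distributive oscal +%R.
Proof. by move=> r x y; exact: mulrDr. Qed.
Let oscalDl x : {morph oscal^~ x : r s / r + s}.
Proof.
move=> r s; rewrite /oscal -mulrDl -oclsD; congr (_ * _); apply/oclsP.
exact: oeqv_CD.
Qed.

HB.instance Definition _ :=
  GRing.Zmodule_isLmodule.Build R Omega oscalA oscal1 oscalDr oscalDl.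

Let oscalAl r (x y : Omega) : r *: (x * y) = r *: x * y.
Proof. exact: mulrA. Qed.

HB.instance Definition _ := GRing.Lmodule_isLalgebra.Build R Omega oscalAl.

HB.instance Definition _ := GRing.Lalgebra_isComAlgebra.Build R Omega.

(* d^(k) r, including d^(0) r = r. *)
Definition od k (r : R) : Omega := ocls (Od k r).

Lemma oclsC r : ocls (OC r) = r%:A.
Proof. by rewrite -[LHS]mulr1. Qed.
Lemma od0 r : od 0 r = r%:A. Proof. exact: oclsC. Qed.

Lemma Omega_ext_od (B : comNzRingType) (f : R -> B) g k r :
  odata f g -> Omega_ext f g (od k r) = g k r.
Proof.
by move=> fg; rewrite Omega_ext_cls //; case: k => //=; case: fg => _ ->.
Qed.

Lemma odD k r s : od k (r + s) = od k r + od k s.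
Proof.
case: k => [|k]; first by rewrite !od0 scalerDl.
by rewrite /od -oclsD; apply/oclsP/oeqv_dD.
Qed.

Lemma odC k a : od k.+1 (a%:A : R) = 0.
Proof. by apply/oclsP/oeqv_dC. Qed.

Lemma odM k r s : od k (r * s) = \sum_(i < k.+1) od i r * od (k - i)%N s.
Proof.
case: k => [|k].
  by rewrite big_ord1 !od0 -scalerAl mul1r scalerA.
rewrite -(big_mkord xpredT (fun i => od i r * od (k.+1 - i)%N s)).
rewrite /index_iota subn0.
transitivity (ocls (Oleibniz k.+1 r s)); first by apply/oclsP/oeqv_dM.
rewrite /Oleibniz; elim: (iota _ _) => [|i l IH] /=; first by rewrite big_nil.
by rewrite oclsD big_cons oclsM IH.
Qed.

(* The direct summand of degree k. *)
Inductive homog : nat -> Omega -> Prop :=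
| homog_0 k : homog k 0
| homog_d k r : homog k (od k r)
| homog_D k x y : homog k x -> homog k y -> homog k (x + y)
| homog_M i j x y : homog i x -> homog j y -> homog (i + j)%N (x * y).

Lemma homogZ k r x : homog k x -> homog k (r *: x).
Proof.
by move=> hx; rewrite -mulr_algl -od0 -[k]add0n; exact: homog_M (homog_d _ _) _.
Qed.

Definition homogb k : {pred Omega} := fun x => `[< homog k x >].

Lemma homogb_submod k : submod_closed (homogb k).
Proof.
split=> [|r x y /asboolP hx /asboolP hy]; apply/asboolP; first exact: homog_0.
by apply: homog_D => //; exact: homogZ.
Qed.

HB.instance Definition _ k :=
  GRing.isSubmodClosed.Build R Omega (homogb k) (homogb_submod k).

Record Omega_deg k := OmegaDeg { oval :> Omega ; _ : oval \in homogb k }.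

HB.instance Definition _ k := [isSub for @oval k].
HB.instance Definition _ k := [Choice of Omega_deg k by <:].
HB.instance Definition _ k :=
  [SubChoice_isSubZmodule of Omega_deg k by <:].
HB.instance Definition _ k :=
  [SubZmodule_isSubLmodule of Omega_deg k by <:].

Lemma odB k : zmod_morphism (od k).
Proof.
move=> r s; apply/eqP; rewrite eq_sym subr_eq.
by rewrite -odD subrK.
Qed.

Lemma od1_subproof r : od 1 r \in homogb 1.
Proof. by apply/asboolP; exact: homog_d. Qed.

Definition od1 (r : R) : Omega_deg 1 := OmegaDeg (od1_subproof r).

Lemma od1_derivation : derivation od1.
Proof.
have odkM r s : od 1 (r * s) = r *: od 1 s + s *: od 1 r.
  rewrite odM big_ord_recr big_ord1 /= !od0 ?subn0 ?subnn ?od0 mulr_algl.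
  by rewrite -scalerAr mulr1.
split=> [r s|a r|r s]; apply: val_inj; rewrite /= ?odD ?odkM //.
by rewrite -(mulr_algl a r) odkM odC scaler0 addr0.
Qed.

(* The canonical map Omega_{R/K} -> Omega_1 with dr |-> d^(1) r. *)
Definition kaehler_deg1 : kaehler R -> Omega_deg 1 := kaehler_ext od1.

(* [dOmega w j] is the part of d_Omega (w) raising degrees by j, so that
   d_Omega (sum_i w_i) = sum_n sum_(i + j = n) dOmega (w_i) j. *)
Definition dOmega_base (r : R) : series Omega := fun j => od j r.

Definition dOmega_gen i (r : R) : series Omega :=
  fun j => od (i + j)%N r *+ 'C(i + j, j).

Lemma dOmega_data : odata dOmega_base dOmega_gen.
Proof.
split.
- split; first by move=> r s; apply: funext => j; exact: odB.
  split; last by move=> r s; apply: funext => j; exact: odM.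
  apply: funext => -[|j]; first by rewrite /dOmega_base od0 scale1r series1.
  by rewrite /dOmega_base -[1](scale1r (1 : R)) odC series1.
- by move=> r; apply: funext => j; rewrite /dOmega_gen add0n binn.
- move=> k r s; apply: funext => j.
  by rewrite /dOmega_gen odB mulrnBl.
- by move=> k a; apply: funext => j; rewrite /dOmega_gen addSn odC mul0rn.
move=> k r s; apply: funext => j; rewrite series_sum /dOmega_gen.
pose F p := od p r * od (k + j - p)%N s.
transitivity (\sum_(c < j.+1) \sum_(p < (k + j).+1)
    F p *+ ('C(p, c) * 'C(k + j - p, j - c))).
  rewrite exchange_big odM -sumrMnl /=; apply: eq_bigr => p _.
  by rewrite sumrMnr binomial.Vandermonde subnKC // -ltnS.
transitivity (\sum_(c < j.+1) \sum_(i < k.+1)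
    (od (i + c)%N r *+ 'C(i + c, c)) *
    (od (k - i + (j - c))%N s *+ 'C(k - i + (j - c), j - c))); last first.
  by rewrite exchange_big.
apply: eq_bigr => c _; have cj : (c <= j)%N by rewrite -ltnS.
rewrite -(big_mkord xpredT (fun p => F p *+ ('C(p, c) * 'C(k + j - p, j - c)))).
rewrite (@big_cat_nat _ _ _ c) //=; last first.
  by rewrite ltnW // ltnS (leq_trans cj) ?leq_addl.
rewrite big_nat big1 ?add0r => [|p /andP[_ pc]]; last by rewrite bin_small.
rewrite (@big_cat_nat _ _ _ (k.+1 + c)) ?leq_addl //=; last first.
  by rewrite addSn ltnS leq_add2l.
rewrite [X in _ + X]big_nat [X in _ + X]big1 ?addr0; last first.
  move=> p /andP[kcp pkj]; rewrite [X in (_ * X)%N]bin_small ?muln0 //.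
  by rewrite ltn_subLR // -ltnS; lia.
rewrite -{1}[c : nat]add0n big_addn addnK big_mkord; apply: eq_bigr => i _.
have ik : (i <= k)%N by rewrite -ltnS.
have -> : (k - i + (j - c) = k + j - (i + c))%N by lia.
by rewrite mulrnAl mulrnAr -mulrnA mulnC.
Qed.

Definition dOmega : Omega -> series Omega := Omega_ext dOmega_base dOmega_gen.

Lemma tilde_data (psi : R -> series R) : HD psi ->
  odata (fun r => smonomial r 0%N : series R)
        (fun k r => smonomial (psi r k) k : series R).
Proof.
move=> [psiB [psi1 psiM] psiZ psi0].
have smB k : zmod_morphism (fun r : R => smonomial r k : series R).
  move=> r s; apply: funext => n; rewrite seriesD seriesN /smonomial.
  by case: eqP => // _; rewrite subr0.
split.
- split; first exact: smB.
  by split=> // r s; rewrite smonomialM.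
- by move=> r; rewrite psi0.
- by move=> k r s; rewrite psiB; exact: smB.
- move=> k a; rewrite psiZ psi1 series1 scaler0.
  by apply: funext => n; rewrite /smonomial if_same.
move=> k r s; rewrite psiM seriesM.
transitivity (\sum_(i < k.+1) smonomial (psi r i * psi s (k - i)%N) k : series R).
  by elim/big_rec2: _ => [|i x y _ <-]; apply: funext => n;
    rewrite ?seriesD /smonomial; case: eqP; rewrite ?addr0.
apply: eq_bigr => i _; rewrite smonomialM. by rewrite subnKC // -ltnS.
Qed.

(* psi~ on the graded algebra; on Omega_k its only coefficient is that of T^k,
   so psi~ (sum_k w_k) = sum_k (Omega_tilde psi (w_k) k) T^k. *)
Definition Omega_tilde (psi : R -> series R) : Omega -> series R :=
  Omega_ext (fun r => smonomial r 0%N : series R)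
            (fun k r => smonomial (psi r k) k : series R).

End HigherDifferentials.

Arguments Omega {K} R.
Arguments kaehler_deg1 {K R}.

Section Connections.
Variables (K : fieldType) (R : comAlgType K) (M : lmodType R).

(* \prod_k (Omega_k (x) M) is the set of series of elements of [OM] with k-th
   coefficient in the summand Omega_k (x) M of [OM], which is [thomog k]. *)
Local Notation OM := (tensor (Omega R) M).

Inductive thomog (k : nat) : OM -> Prop :=
| thomog_0 : thomog k 0
| thomog_tens w m : homog k w -> thomog k (tens w m)
| thomog_D x y : thomog k x -> thomog k y -> thomog k (x + y).

Definition oact (w : Omega R) : OM -> OM :=
  tensor_ext (fun v m => tens (w * v) m).

Definition higher_connection (nabla : M -> series OM) :=
  [/\ zmod_morphism nabla,
      forall m k, thomog k (nabla m k),
      forall r m, nabla (r *: m) = sact oact (fun k => od k r) (nabla m) &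
      forall m, nabla m 0%N = tens 1 m].

Lemma oact_balanced w : balanced (fun (v : Omega R) (m : M) => tens (w * v) m).
Proof.
split=> [x y m|x m n|r x m]; rewrite ?mulrDr ?tensDl ?tensDr //.
by rewrite -scalerAr tens_bal.
Qed.

Lemma oact_tens w v m : oact w (tens v m) = tens (w * v) m.
Proof. exact: tensor_ext_tens (oact_balanced w) _ _. Qed.

Lemma oactDr w : {morph oact w : x y / x + y}.
Proof. exact: tensor_extD (oact_balanced w). Qed.

Lemma oact0r w : oact w 0 = 0.
Proof. by apply: (addrI (oact w 0)); rewrite -oactDr !addr0. Qed.

Lemma oactDl x : {morph oact^~ x : v w / v + w}.
Proof.
move=> v w; elim/tensor_ind: x => [|u m|x y IHx IHy].
- by rewrite !oact0r addr0.
- by rewrite !oact_tens mulrDl tensDl.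
- by rewrite !oactDr IHx IHy addrACA.
Qed.

Lemma oactA v w x : oact (v * w) x = oact v (oact w x).
Proof.
elim/tensor_ind: x => [|u m|x y IHx IHy]; first by rewrite !oact0r.
  by rewrite !oact_tens mulrA.
by rewrite !oactDr IHx IHy.
Qed.

(* The degree-i part of w (x) x |-> d_Omega (w) nabla (x). *)
Definition Omega_nabla (nabla : M -> series OM) (i : nat) : OM -> OM :=
  tensor_ext (fun w x => sact oact (dOmega w) (nabla x) i).

Lemma Omega_nabla_balanced nabla i : higher_connection nabla ->
  balanced (fun w x => sact oact (dOmega w) (nabla x) i).
Proof.
move=> [nB _ nZ _]; have fg := dOmega_data R; split=> [v w m|w m n|r w m].
- rewrite /dOmega Omega_extD // /sact -big_split /=.
  by apply: eq_bigr => j _; exact: oactDl.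
- have nD : nabla (m + n) = nabla m + nabla n.
    have n0 : nabla 0 = 0 by rewrite -(subrr 0) nB subrr.
    by rewrite -{1}[n]opprK nB -(sub0r n) nB n0 sub0r opprK.
  rewrite nD /sact -big_split /=.
  by apply: eq_bigr => j _; exact: oactDr.
- rewrite -mulr_algl -od0 mulrC /dOmega Omega_extM // Omega_ext_od // nZ.
  rewrite sactA; [| exact: oactDl | exact: oactDr | exact: oactA].
  congr (sact _ _ (sact _ _ _) _); case: fg => _ -> _ _ _.
  by apply: funext.
Qed.

Definition iterative_connection (nabla : M -> series OM) :=
  higher_connection nabla /\
  forall i j x, Omega_nabla nabla i (Omega_nabla nabla j x) =
                Omega_nabla nabla (i + j)%N x *+ 'C(i + j, i).

Definition nabla_at (nabla : M -> series OM) (psi : R -> series R) (m : M) :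
    series M :=
  fun k => tensor_ext (fun w x => Omega_tilde psi w k *: x) (nabla m k).

Lemma nabla_at_balanced psi k : HD psi ->
  balanced (fun (w : Omega R) (x : M) => Omega_tilde psi w k *: x).
Proof.
move=> hpsi; have fg := tilde_data hpsi.
rewrite /Omega_tilde; split=> [v w m|w m n|r w m].
- by rewrite Omega_extD // seriesD scalerDl.
- by rewrite scalerDr.
rewrite -mulr_algl -od0 mulrC Omega_extM // Omega_ext_od // seriesM.
case: hpsi => _ _ _ psi0; rewrite big_ord_recr big1 /=; last first.
  move=> i _; rewrite /smonomial subn_eq0 leqNgt ltn_ord /=; exact: mulr0.
by rewrite add0r /smonomial subnn eqxx psi0 scalerA.
Qed.

Definition integrable (nabla : M -> series OM) :=
  forall psi1 psi2, HD psi1 -> HD psi2 -> forall m,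
    nabla_at nabla (scomp psi1 psi2) m =
    scomp (nabla_at nabla psi1) (nabla_at nabla psi2) m.

Definition connection (c : M -> tensor (kaehler R) M) :=
  [/\ {morph c : x y / x + y},
      forall (a : K) m, c (a%:A *: m) = a%:A *: c m &
      forall r m, c (r *: m) = tens (kd r) m + r *: c m].

Definition connection_at (c : M -> tensor (kaehler R) M) (d : R -> R) (m : M) :
    M :=
  tensor_ext (fun w x => (kaehler_ext (d : R -> R^o) w : R) *: x) (c m).

Lemma connection_at_balanced d : Der d ->
  balanced (fun w (x : M) => (kaehler_ext (d : R -> R^o) w : R) *: x).
Proof.
move=> hd; have lin := kaehler_ext_linear hd.
have linD v w : kaehler_ext (d : R -> R^o) (v + w) =
    kaehler_ext (d : R -> R^o) v + kaehler_ext (d : R -> R^o) w.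
  by rewrite -{1}[v]scale1r lin scale1r.
have lin0 : kaehler_ext (d : R -> R^o) 0 = 0.
  by apply: (addrI (kaehler_ext (d : R -> R^o) 0)); rewrite -linD !addr0.
split=> [v w m|w m n|r w m]; first by rewrite linD scalerDl.
  by rewrite scalerDr.
by rewrite -[r *: w]addr0 lin lin0 addr0 scalerA mulrC.
Qed.

Definition integrable_connection (c : M -> tensor (kaehler R) M) :=
  forall d1 d2, Der d1 -> Der d2 -> forall m,
    connection_at c d1 (connection_at c d2 m) -
    connection_at c d2 (connection_at c d1 m) =
    connection_at c (bracket d1 d2) m.

(* The identification of Omega_{R/K} (x) M with Omega_1 (x) M. *)
Definition tensor_deg1 : tensor (kaehler R) M -> OM :=
  tensor_ext (fun w m => tens (oval (kaehler_deg1 w)) m).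

Lemma tensor_deg1_balanced :
  balanced (fun w (m : M) => tens (oval (kaehler_deg1 (R := R) w)) m).
Proof.
have lin := kaehler_ext_linear (od1_derivation R).
have linD v w : kaehler_deg1 (R := R) (v + w) = kaehler_deg1 v + kaehler_deg1 w.
  by rewrite /kaehler_deg1 -{1}[v]scale1r lin scale1r.
have lin0 : kaehler_deg1 (R := R) 0 = 0.
  by apply: (addrI (kaehler_deg1 0)); rewrite -linD !addr0.
split=> [v w m|w m n|r w m]; first by rewrite linD tensDl.
  by rewrite tensDr.
by rewrite -tens_bal -[r *: w]addr0 /kaehler_deg1 lin -/kaehler_deg1 lin0 addr0.
Qed.

End Connections.

(* Main.v *)
(** In characteristic zero every iterative object is the exponential of its
    degree-one part D: from F^(n+1) (n+1) = D F^(n) one gets n! F^(n) = D^n.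
    This gives (i), and also existence and uniqueness in (iii), where D is the
    connection extended to a derivation of the module of higher differentials
    over the part of d_Omega raising degrees by 1.

    For the integrability statement, let psi be a higher derivation and
    theta = psi^-1 psi' (derivative in T) its logarithmic derivative, a power
    series of derivations.  The family N = nabla_psi satisfies the linear
    differential equation N' = N c(theta), where c is the connection.  If c is a
    Lie algebra morphism then c(D) N = N c(psi^-1 D psi), as both sides satisfy
    the same differential equation; hence nabla_psi1 nabla_psi2 has the same
    logarithmic derivative as nabla_(psi1 psi2), and the two are equal.
    Conversely, the coefficient of T^2 in this equality for psi_i = exp(d_i T)
    is the integrability of c. *)

Require Import Defs.
From HB Require Import structures.
From mathcomp Require Import all_boot all_order all_algebra all_field.
From mathcomp Require Import boolp zify ring.

Set Implicit Arguments.
Unset Strict Implicit.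
Unset Printing Implicit Defensive.

Import GRing.Theory.
Local Open Scope ring_scope.

(** * Additive maps between abelian groups *)

Section AdditiveMaps.
Variables (V W : zmodType) (f : V -> W).

Lemma zmod_morphD : zmod_morphism f -> {morph f : x y / x + y}.
Proof.
move=> fB x y; have f0 : f 0 = 0 by rewrite -(subrr 0) fB subrr.
by rewrite -{1}[y]opprK fB -(sub0r y) fB f0 sub0r opprK.
Qed.

Hypothesis fD : {morph f : x y / x + y}.

Lemma morphD0 : f 0 = 0.
Proof. by apply: (addrI (f 0)); rewrite -fD !addr0. Qed.

Lemma morphDB : zmod_morphism f.
Proof. by move=> x y; apply: (addIr (f y)); rewrite -fD !subrK. Qed.

Lemma morphDMn x n : f (x *+ n) = f x *+ n.
Proof. by elim: n => [|n IH]; rewrite ?morphD0 // !mulrS fD IH. Qed.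

Lemma morphD_sum I r (P : pred I) (F : I -> V) :
  f (\sum_(i <- r | P i) F i) = \sum_(i <- r | P i) f (F i).
Proof. exact: (big_morph f fD morphD0). Qed.

End AdditiveMaps.

(** * Reindexing and differentiation of Cauchy sums *)

Section CauchySums.
Variable V : zmodType.

(** Both sides run over all triples of indices with sum n. The same reindexing serves products of
    series and compositions of the maps [sext F]. *)
Lemma cauchy_sumA (H : nat -> nat -> nat -> V) n :
  \sum_(i < n.+1) \sum_(j < i.+1) H j (i - j)%N (n - i)%N =
  \sum_(i < n.+1) \sum_(j < (n - i).+1) H i j (n - i - j)%N.
Proof.
transitivity
  (\sum_(0 <= i < n.+1) \sum_(0 <= j < n.+1 | (j <= i)%N) H j (i - j)%N (n - i)%N).
  rewrite [RHS]big_mkord; apply: eq_bigr => i _.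
  rewrite -(big_mkord xpredT (fun j => H j (i - j)%N (n - i)%N)).
  by rewrite (big_nat_widen 0 i.+1 n.+1).
rewrite (exchange_big_dep_nat xpredT) //= [LHS]big_mkord.
apply: eq_bigr => j _; have jn : (j <= n)%N by rewrite -ltnS.
transitivity (\sum_(j <= i < n.+1) H j (i - j)%N (n - i)%N).
  rewrite (@big_cat_nat _ _ _ j) ?(leq_trans jn) //= big_nat_cond big1 ?add0r.
    by rewrite big_nat_cond [RHS]big_nat; apply: eq_bigl => i; lia.
  by move=> i; lia.
rewrite -{1}[j : nat]add0n big_addn subSn // big_mkord; apply: eq_bigr => b _.
by rewrite addnK; congr (H _ _ _); lia.
Qed.

Lemma cauchy_sumC (H : nat -> nat -> V) n :
  \sum_(i < n.+1) H i (n - i)%N = \sum_(i < n.+1) H (n - i)%N i.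
Proof.
rewrite (reindex_inj rev_ord_inj) /=; apply: eq_bigr => i _.
by rewrite subSS subKn // -ltnS.
Qed.

(** The weight n + 1 splits as i + (n + 1 - i); in each half the term of weight 0 drops out and the
    index shifts. With H arbitrary this gives the Leibniz rule for [sact] and for [sext] at once. *)
Lemma cauchy_sum_deriv (H : nat -> nat -> V) n :
  (\sum_(i < n.+2) H i (n.+1 - i)%N) *+ n.+1 =
  \sum_(i < n.+1) H i.+1 (n - i)%N *+ i.+1 +
  \sum_(i < n.+1) H i (n - i).+1 *+ (n - i).+1.
Proof.
rewrite -sumrMnl.
transitivity (\sum_(i < n.+2) H i (n.+1 - i)%N *+ i +
              \sum_(i < n.+2) H i (n.+1 - i)%N *+ (n.+1 - i)).
  rewrite -big_split /=; apply: eq_bigr => i _.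
  by rewrite -mulrnDr subnKC // -ltnS.
congr (_ + _); first by rewrite big_ord_recl mulr0n add0r.
rewrite big_ord_recr /= subnn mulr0n addr0.
by apply: eq_bigr => i _; rewrite subSn // -ltnS.
Qed.

End CauchySums.

(** * The formal derivative in T *)

Definition sderiv (V : zmodType) (g : series V) : series V :=
  fun n => g n.+1 *+ n.+1.

Lemma sderivD (V : zmodType) : {morph @sderiv V : f g / f + g}.
Proof. by move=> f g; apply: funext => n; rewrite /sderiv !seriesD mulrnDl. Qed.

Lemma sderiv_sact (A V : zmodType) (act : A -> V -> V) :
  (forall v, {morph act^~ v : a b / a + b}) ->
  (forall a, {morph act a : v w / v + w}) ->
  forall f g, sderiv (sact act f g) =
    sact act (sderiv f) g + sact act f (sderiv g).
Proof.
move=> aDl aDr f g; apply: funext => n.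
rewrite seriesD /sderiv /sact (cauchy_sum_deriv (fun i j => act (f i) (g j))).
congr (_ + _); apply: eq_bigr => i _.
  by rewrite (morphDMn (aDl _)).
by rewrite (morphDMn (aDr _)).
Qed.

Lemma sderivM (A : comNzRingType) (f g : series A) :
  sderiv (f * g) = sderiv f * g + f * sderiv g.
Proof.
by apply: sderiv_sact => [v a b|a v w]; rewrite ?mulrDl ?mulrDr.
Qed.

(** * The extension F[[T]] and its invertibility *)

Section SeriesExtension.
Variables (V : zmodType) (F : V -> series V).
Hypothesis FD : {morph F : x y / x + y}.

Lemma series_coefD n : {morph F^~ n : x y / x + y}.
Proof. by move=> x y; rewrite FD. Qed.

Lemma sextD : {morph sext F : g h / g + h}.
Proof.
move=> g h; apply: funext => n; rewrite seriesD /sext -big_split /=.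
by apply: eq_bigr => i _; rewrite -series_coefD.
Qed.

(** Associativity of [scomp]: additivity of F lets the Cauchy sum that defines G[[T]] be pulled
    out. *)
Lemma sext_scomp G g : sext F (sext G g) = sext (scomp F G) g.
Proof.
apply: funext => n; rewrite /scomp /sext.
rewrite -(cauchy_sumA (fun a b c => F (G (g a) b) c)).
by apply: eq_bigr => i _; rewrite (morphD_sum (series_coefD _)).
Qed.

Lemma sderiv_sext g :
  sderiv (sext F g) = sext (fun x => sderiv (F x)) g + sext F (sderiv g).
Proof.
apply: funext => n; rewrite seriesD /sderiv /sext.
rewrite (cauchy_sum_deriv (fun i j => F (g i) j)) addrC; congr (_ + _).
by apply: eq_bigr => i _; rewrite (morphDMn (series_coefD _)).
Qed.

Hypothesis F0 : forall x, F x 0%N = x.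

(** F[[T]] is unitriangular because F starts with the identity; injectivity and surjectivity both
    rest on this. *)
Lemma sext_recr g n :
  sext F g n = \sum_(i < n) F (g i) (n - i)%N + g n.
Proof. by rewrite /sext big_ord_recr /= subnn F0. Qed.

Lemma sext_inj : injective (sext F).
Proof.
move=> g h gh; apply: funext => n; elim/ltn_ind: n => n IH.
have := congr1 (fun f => f n) gh; rewrite /= !sext_recr.
rewrite [X in X + _ = _](eq_bigr (fun i : 'I_n => F (h i) (n - i)%N)).
  exact: addrI.
by move=> i _; rewrite IH.
Qed.

Lemma sext_surj g : exists h, sext F h = g.
Proof.
(* A fixed point of the T-adic contraction h |-> g + h - F[[T]] h. *)
pose step (h : series V) : series V :=
  fun n => g n - \sum_(i < n) F (h i) (n - i)%N.
have stepP h h' n : (forall i, (i < n)%N -> h i = h' i) -> step h n = step h' n.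
  by move=> hh'; congr (_ - _); apply: eq_bigr => i _; rewrite hh'.
(* Coefficient n of [step h] depends only on lower coefficients of h, so it is stationary from the
   iterate n + 1 on. The fixed point collects these stable values. *)
have iterP n m : (n < m)%N -> iter m step 0 n = iter n.+1 step 0 n.
  elim/ltn_ind: n m => n IH [//|m] nm /=; apply: stepP => i ni.
  by rewrite (IH i ni m (leq_trans ni nm)) (IH i ni n ni).
exists (fun n => iter n.+1 step 0 n); apply: funext => n.
rewrite sext_recr /= {2}/step addrC -[RHS](subrK (\sum_(i < n) F (iter n step 0 i) (n - i)%N)).
congr (_ + _); apply: eq_bigr => i _; congr (F _ _).
by rewrite (iterP i n).
Qed.

End SeriesExtension.

(** * Torsion-free groups: differential equations and divided powers *)

Definition torsion_free (V : zmodType) :=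
  forall (x y : V) n, x *+ n.+1 = y *+ n.+1 -> x = y.

Section DividedPowers.
Variable V : zmodType.
Hypothesis Vtf : torsion_free V.

Lemma mulrn_fact_inj (x y : V) n : x *+ n`! = y *+ n`! -> x = y.
Proof. by case: n`! (fact_gt0 n) => // m _; exact: Vtf. Qed.

(** The equation expresses (n + 1) times coefficient n + 1 through coefficients up to n, so the
    value at T = 0 fixes the solution. The induction is uniform in x, since the equation involves F
    at the points [C x i]. *)
Lemma ode_unique (F G C : V -> series V) :
  (forall x, F x 0%N = G x 0%N) ->
  (forall x, sderiv (F x) = sext F (C x)) ->
  (forall x, sderiv (G x) = sext G (C x)) -> F = G.
Proof.
move=> FG0 F' G'; apply: funext => x; apply: funext => n.
elim/ltn_ind: n x => -[//|n] IH x; apply: (@Vtf _ _ n).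
rewrite -[LHS]/(sderiv (F x) n) -[RHS]/(sderiv (G x) n) F' G'.
by apply: eq_bigr => i _; rewrite IH // ltnS leq_subr.
Qed.

Variable D : V -> V.
Hypothesis DD : {morph D : x y / x + y}.

Lemma iter_recP (G : nat -> V) : (forall n, G n.+1 *+ n.+1 = D (G n)) ->
  forall n, G n *+ n`! = iter n D (G 0%N).
Proof.
by move=> Grec; elim=> // n IH; rewrite factS mulrnA Grec -morphDMn // IH.
Qed.

Lemma iterDP n : {morph iter n D : x y / x + y}.
Proof. by elim: n => // n IH x y; rewrite !iterS IH DD. Qed.

(** Multiplied by i! j!, both sides become D^(i+j) x, because C(i+j, i) i! j! = (i+j)!. *)
Lemma divided_iterate (F : nat -> V -> V) :
  (forall n x, F n x *+ n`! = iter n D x) ->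
  forall i j x, F i (F j x) = F (i + j)%N x *+ 'C(i + j, i).
Proof.
move=> FP i j x; apply: (@mulrn_fact_inj _ _ j); apply: (@mulrn_fact_inj _ _ i).
have -> : F (i + j)%N x *+ 'C(i + j, i) *+ j`! *+ i`! = F (i + j)%N x *+ (i + j)`!.
  rewrite -!mulrnA -(bin_fact (leq_addr j i)) addKn; congr (_ *+ _).
  by rewrite [(j`! * _)%N]mulnC.
by rewrite mulrnAC (FP i (F j x)) -(morphDMn (iterDP i)) !FP iterD.
Qed.

Lemma divided_rec (F : nat -> V -> V) :
  (forall n x, F n x *+ n`! = iter n D x) ->
  forall n x, F n.+1 x *+ n.+1 = D (F n x).
Proof.
move=> FP n x; apply: (@mulrn_fact_inj _ _ n).
by rewrite -mulrnA -factS FP iterS -FP morphDMn.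
Qed.

End DividedPowers.

(** By the Leibniz rule for [dV], a product of two exponential solutions is again one. All
    multiplicativity statements for exponentials reduce to this. *)
Lemma exp_sact (A V : zmodType) (act : A -> V -> V) (dA : A -> A) (dV : V -> V)
    (f : series A) (g : series V) :
  (forall v, {morph act^~ v : a b / a + b}) ->
  (forall a, {morph act a : v w / v + w}) ->
  {morph dV : x y / x + y} ->
  (forall a v, dV (act a v) = act (dA a) v + act a (dV v)) ->
  (forall n, f n.+1 *+ n.+1 = dA (f n)) ->
  (forall n, g n.+1 *+ n.+1 = dV (g n)) ->
  forall n, sact act f g n.+1 *+ n.+1 = dV (sact act f g n).
Proof.
move=> aDl aDr dVD dVact f' g' n.
rewrite -[LHS]/(sderiv (sact act f g) n) sderiv_sact // seriesD /sact.
rewrite (morphD_sum dVD) -big_split /=; apply: eq_bigr => i _.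
by rewrite dVact /sderiv f' g'.
Qed.

(** * Exponentials of derivations in characteristic zero *)

Section CharacteristicZero.
Variables (K : fieldType) (R : comAlgType K).
Hypothesis K_char0 : [pchar K] =i pred0.

Lemma natr_char0 n : (n.+1%:R : K) != 0.
Proof. by have /pcharf0P -> := K_char0. Qed.

Lemma factr_char0 n : (n`!%:R : K) != 0.
Proof. by case: n`! (fact_gt0 n) => // m _; exact: natr_char0. Qed.

Lemma lmod_torsion_free (M : lmodType R) : torsion_free M.
Proof.
move=> x y n xy; pose c : R := (n.+1%:R^-1 : K)%:A.
have cK z : c *: (z *+ n.+1) = z :> M.
  rewrite -scalerMnr scalerMnl /c scalerMnl -mulr_natr mulVf ?natr_char0 //.
  by rewrite !scale1r.
by rewrite -[x]cK -[y]cK xy.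
Qed.

Lemma alg_torsion_free : torsion_free R.
Proof. exact: (@lmod_torsion_free R^o). Qed.

Lemma exp_DerP (d : R -> R) n r : exp_Der d r n *+ n`! = iter n d r.
Proof.
by rewrite /exp_Der scalerMnl -mulr_natr mulVf ?scale1r ?factr_char0.
Qed.

Lemma exp_Der_overP (M : lmodType R) (dM : M -> M) n m :
  exp_Der_over dM m n *+ n`! = iter n dM m.
Proof.
rewrite /exp_Der_over scalerMnl scalerMnl -mulr_natr mulVf ?factr_char0 //.
by rewrite !scale1r.
Qed.

Section Ring.
Variable d : R -> R.
Hypothesis dP : Der d.

Lemma DerD : {morph d : r s / r + s}. Proof. by case: dP. Qed.

Lemma DerM r s : d (r * s) = d r * s + r * d s.
Proof. by case: dP => _ _ ->; rewrite addrC [d r * s]mulrC. Qed.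

Lemma DerZ (a : K) r : d (a *: r) = a *: d r.
Proof. by case: dP => _ -> _; exact: mulr_algl. Qed.

Lemma Der_alg (a : K) : d a%:A = 0.
Proof.
rewrite DerZ; have := DerM 1 1; rewrite !mulr1 mul1r => /eqP.
by rewrite addrC -subr_eq subrr => /eqP <-; rewrite scaler0.
Qed.

Lemma exp_Der_rec n r : exp_Der d r n.+1 *+ n.+1 = d (exp_Der d r n).
Proof.
exact: (divided_rec alg_torsion_free DerD (F := fun n => (exp_Der d)^~ n))
  (exp_DerP d) n r.
Qed.

(** The right side satisfies the recursion of the exponential by [exp_sact] and starts at r s, so n!
    times its coefficient of T^n is d^n (r s). *)
Lemma exp_DerM r s : exp_Der d (r * s) = exp_Der d r * exp_Der d s.
Proof.
apply: funext => n; apply: (mulrn_fact_inj alg_torsion_free (n := n)).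
rewrite exp_DerP (iter_recP DerD).
  by rewrite seriesM big_ord1 /exp_Der fact0 invr1 !scale1r.
apply: (exp_sact (dA := d)).
- by move=> v a b; exact: mulrDl.
- by move=> a v w; exact: mulrDr.
- exact: DerD.
- exact: DerM.
- by move=> {}n; exact: exp_Der_rec.
- by move=> {}n; exact: exp_Der_rec.
Qed.

Lemma exp_Der_ID : ID (exp_Der d).
Proof.
split; last first.
  exact: (divided_iterate alg_torsion_free DerD (F := fun n => (exp_Der d)^~ n))
    (exp_DerP d).
split.
- apply: morphDB => r s; apply: funext => n.
  by rewrite seriesD /exp_Der (iterDP DerD) scalerDr.
- split; last exact: exp_DerM.
  apply: funext => -[|n]; rewrite series1 /exp_Der ?fact0 ?invr1 ?scale1r //.
  have d1 : d 1 = 0 by have := Der_alg 1; rewrite scale1r.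
  by rewrite iterSr d1 (morphD0 (iterDP DerD n)) scaler0.
- move=> a r n; rewrite /exp_Der.
  have -> : iter n d (a *: r) = a *: iter n d r.
    by elim: n => //= n ->; rewrite DerZ.
  by rewrite !scalerA mulrC.
- by move=> r; rewrite /exp_Der fact0 invr1 scale1r.
Qed.

Variable M : lmodType R.

Lemma exp_Der_over_rec (dM : M -> M) : {morph dM : x y / x + y} ->
  forall n m, exp_Der_over dM m n.+1 *+ n.+1 = dM (exp_Der_over dM m n).
Proof.
move=> dMD n m.
exact: (divided_rec (@lmod_torsion_free M) dMD
  (F := fun n => (exp_Der_over dM)^~ n)) (exp_Der_overP dM) n m.
Qed.

Lemma exp_Der_over_ID (dM : M -> M) : Der_over d dM ->
  ID_over (exp_Der d) (exp_Der_over dM).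
Proof.
move=> [dMD dMZ]; have Mtf := @lmod_torsion_free M.
split.
- apply: morphDB => r s; apply: funext => n.
  by rewrite seriesD /exp_Der_over (iterDP dMD) scalerDr.
- by move=> m; rewrite /exp_Der_over fact0 invr1 !scale1r.
- move=> r m; apply: funext => n; apply: (mulrn_fact_inj Mtf (n := n)).
  rewrite exp_Der_overP (iter_recP dMD).
    by rewrite /sact big_ord1 /exp_Der_over /exp_Der fact0 invr1 !scale1r.
  apply: (exp_sact (dA := d)) => //.
  - by move=> v a b; exact: scalerDl.
  - by move=> a v w; exact: scalerDr.
  - by move=> {}n; exact: exp_Der_rec.
  - by move=> {}n; exact: exp_Der_over_rec.
exact: (divided_iterate Mtf dMD (F := fun n => (exp_Der_over dM)^~ n))
  (exp_Der_overP dM).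
Qed.

Lemma ID_over_Der (Phi : M -> series M) : ID_over (exp_Der d) Phi ->
  Der_over d (Phi^~ 1%N).
Proof.
move=> [PhiB Phi0 PhiZ _]; split=> [x y|r m].
  by rewrite (zmod_morphD PhiB).
rewrite PhiZ /sact big_ord_recr big_ord1 /= subn0 subnn Phi0 addrC.
by rewrite /exp_Der /= fact0 invr1 !scale1r.
Qed.

(** Iterativity with i = 1 reads (n + 1) Phi^(n+1) = Phi^(1) Phi^(n), so Phi is recovered from
    Phi^(1). *)
Lemma exp_Der_over_bij :
  inverse_bijections (@Der_over K R d M) (ID_over (exp_Der d))
    (@exp_Der_over K R M) (fun Phi m => Phi m 1%N).
Proof.
split; [exact: exp_Der_over_ID | exact: ID_over_Der | |].
  move=> dM _; apply: funext => m.
  by rewrite /exp_Der_over /= invr1 !scale1r.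
move=> Phi PhiP; have [PhiD _] := ID_over_Der PhiP.
case: PhiP => _ Phi0 _ PhiI.
apply: funext => m; apply: funext => n.
apply: (mulrn_fact_inj (@lmod_torsion_free M) (n := n)).
rewrite exp_Der_overP (iter_recP PhiD) ?Phi0 // => {}n.
by rewrite PhiI add1n bin1.
Qed.

End Ring.

Lemma HD_Der phi : HD phi -> Der (phi^~ 1%N : R -> R).
Proof.
move=> [phiB [_ phiM] phiZ phi0]; split=> [r s|a r|r s].
- by rewrite (zmod_morphD phiB).
- by rewrite phiZ -[LHS]mulr_algl.
rewrite phiM seriesM big_ord_recr big_ord1 /= subnn subn0 !phi0 mulrC.
by rewrite mulrC [phi r _ * _]mulrC.
Qed.

Lemma exp_Der_bij :
  inverse_bijections (@Der K R) (@ID K R) (@exp_Der K R)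
    (fun phi r => phi r 1%N).
Proof.
split; [exact: exp_Der_ID | by move=> phi [/HD_Der] | |].
  by move=> d _; apply: funext => r; rewrite /exp_Der /= invr1 scale1r.
move=> phi [phiH phiI]; have [_ _ _ phi0] := phiH.
have [phiD _ _] := HD_Der phiH.
apply: funext => r; apply: funext => n.
apply: (mulrn_fact_inj alg_torsion_free (n := n)).
rewrite exp_DerP (iter_recP phiD) ?phi0 // => {}n.
by rewrite phiI add1n bin1.
Qed.

End CharacteristicZero.

(** * Square-zero extensions of a ring by a module *)

Section SquareZeroExtension.
Variables (R : comNzRingType) (N : lmodType R).

(** A target for ring homomorphisms out of [Omega R] that isolates degree 1. The product to be put
    on these pairs is not componentwise: N squares to zero. *)
Definition sqzero : Type := (R * N)%type.

HB.instance Definition _ := GRing.Zmodule.on sqzero.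

Implicit Types u v w : sqzero.

Let smul u v : sqzero := (u.1 * v.1, u.1 *: v.2 + v.1 *: u.2).

Let smulA : associative smul.
Proof.
move=> u v w; rewrite /smul /= mulrA; congr (_, _).
by rewrite !scalerDr !scalerA addrA mulrC [w.1 * u.1]mulrC [w.1 * v.1]mulrC.
Qed.
Let smulC : commutative smul.
Proof. by move=> u v; rewrite /smul mulrC addrC. Qed.
Let smul1 : left_id ((1, 0) : sqzero) smul.
Proof. by case=> a x; rewrite /smul /= mul1r scale1r scaler0 addr0. Qed.
Let smulDl : left_distributive smul +%R.
Proof.
move=> u v w; rewrite /smul /= mulrDl scalerDl scalerDr; congr (_, _).
by rewrite addrACA.
Qed.
Let sone_neq0 : ((1, 0) : sqzero) != 0.
Proof. by rewrite xpair_eqE oner_eq0. Qed.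

HB.instance Definition _ :=
  GRing.Zmodule_isComNzRing.Build sqzero smulA smulC smul1 smulDl sone_neq0.

Lemma sqzeroM u v : u * v = (u.1 * v.1, u.1 *: v.2 + v.1 *: u.2).
Proof. by []. Qed.

End SquareZeroExtension.

(** * Degree one of the higher differentials and Kaehler differentials *)

Section DegreeOne.
Variables (K : fieldType) (R : comAlgType K).

(** Scalars come from [od 0 r], and the opposite of an element is its product with [od 0 (-1)]. *)
Lemma Omega_ind (P : Omega R -> Prop) :
  (forall k r, P (od k r)) -> (forall x y, P x -> P y -> P (x + y)) ->
  (forall x y, P x -> P y -> P (x * y)) -> forall x, P x.
Proof.
move=> Pd PD PM; elim/ocls_ind; elim=> [r|k r|t Pt u Pu|t Pt|t Pt u Pu].
- exact: (Pd 0%N).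
- exact: (Pd k.+1).
- by rewrite oclsD; exact: PD.
- rewrite oclsN -[ocls t]mul1r -mulNr; apply: PM => //.
  by have := Pd 0%N (-1); rewrite od0 scaleN1r.
- by rewrite oclsM; exact: PM.
Qed.

Lemma kaehler_ind (P : kaehler R -> Prop) :
  (forall r s, P (r *: kd s)) -> (forall x y, P x -> P y -> P (x + y)) ->
  forall x, P x.
Proof.
(* A scalar is put in front and generalised, which lets the induction pass through scaled terms and
   opposites. *)
move=> Pd PD; elim/kcls_ind => t; rewrite -[kcls t]scale1r; move: (1 : R).
elim: t => [|s|t Pt u Pu|t Pt|s t Pt] r.
- by rewrite kcls0 scaler0 -(scale0r (kd 0)).
- exact: Pd.
- by rewrite kclsD scalerDr; exact: PD.
- by rewrite kclsN scalerN -scaleNr.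
- by rewrite kclsZ scalerA.
Qed.

Let sq0 (r : R) : sqzero (kaehler R) := (r, 0).
(** Values of d^(k) r under the homomorphism that kills all degrees above 1 and sends d^(1) r to
    dr. *)
Let sq (k : nat) (r : R) : sqzero (kaehler R) :=
  match k with 0 => (r, 0) | 1 => (0, kd r) | _ => 0 end.

Lemma kdB : zmod_morphism (@kd K R).
Proof. by apply: morphDB; case: (kd_derivation R). Qed.

Let sq_data : odata sq0 sq.
Proof.
have kdA (a : K) : kd (a%:A : R) = 0.
  have [_ kdZ kdM] := kd_derivation R.
  have kd1 : kd (1 : R) = 0.
    have := kdM 1 1; rewrite mulr1 !scale1r => /eqP.
    by rewrite addrC -subr_eq subrr => /eqP <-.
  by rewrite kdZ kd1 scaler0.
split=> //.
- split; first by move=> r s; congr (_, _); rewrite subr0.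
  split=> // r s; rewrite /sq0 sqzeroM /=.
  by rewrite !scaler0 addr0.
- move=> [|[|k]] r s /=; rewrite ?subr0 //.
    by congr (_, _); rewrite subr0.
  by rewrite kdB; congr (_, _); rewrite subr0.
- by move=> [|k] a //=; rewrite kdA.
(* Degree 2 is where the square-zero product enters, through dr ds = 0; in higher degrees every
   product has a factor of degree at least 2. *)
move=> [|[|[|k]]] r s.
- by rewrite big_ord1 sqzeroM /= !scaler0 addr0.
- rewrite big_ord_recr big_ord1 /= !sqzeroM /= !mul0r !mulr0.
  rewrite !scaler0 add0r addr0.
  by have [_ _ ->] := kd_derivation R; congr (_, _); rewrite addr0.
- rewrite !big_ord_recr big_ord0 /= !sqzeroM /=.
  by rewrite !mul0r !mulr0 !scale0r !scaler0 !addr0.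
by rewrite big1 // => -[[|[|i]] ilt] _; rewrite ?mul0r //= mulr0.
Qed.

(* The projection of Omega onto Omega_1, read in Omega_{R/K}. *)
Definition Omega_kaehler (w : Omega R) : kaehler R := (Omega_ext sq0 sq w).2.

Lemma Omega_kaehlerD : {morph Omega_kaehler : v w / v + w}.
Proof. by move=> v w; rewrite /Omega_kaehler Omega_extD. Qed.

Lemma Omega_kaehlerZ r w : Omega_kaehler (r *: w) = r *: Omega_kaehler w.
Proof.
rewrite /Omega_kaehler -mulr_algl -od0 Omega_extM // Omega_ext_od //.
by rewrite sqzeroM /= scaler0 addr0.
Qed.

Lemma kaehler_deg1_linear : linear (@kaehler_deg1 K R).
Proof. exact: kaehler_ext_linear (od1_derivation R). Qed.

Lemma kaehler_deg1D : {morph @kaehler_deg1 K R : v w / v + w}.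
Proof.
by move=> v w; have := kaehler_deg1_linear 1 v w; rewrite !scale1r.
Qed.

Lemma kaehler_deg1Z r w : @kaehler_deg1 K R (r *: w) = r *: kaehler_deg1 w.
Proof.
have := kaehler_deg1_linear r w 0; rewrite !addr0 => ->.
by rewrite (morphD0 kaehler_deg1D) addr0.
Qed.

Lemma kaehler_deg1_kd (r : R) : kaehler_deg1 (kd r) = od1 r.
Proof. exact: kaehler_ext_kd (od1_derivation R) r. Qed.

(** This retraction shows that the relations of the higher differentials impose nothing new on the
    dr in degree 1. *)
Lemma kaehler_deg1K w : Omega_kaehler (oval (@kaehler_deg1 K R w)) = w.
Proof.
elim/kaehler_ind: w => [r s|v w IHv IHw].
  rewrite kaehler_deg1Z /= Omega_kaehlerZ kaehler_deg1_kd.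
  by rewrite /Omega_kaehler Omega_ext_od.
by rewrite kaehler_deg1D /= Omega_kaehlerD IHv IHw.
Qed.

Lemma homog0P w : homog 0 w -> exists r : R, w = r%:A.
Proof.
suff H k v : homog k v -> k = 0%N -> exists r : R, v = r%:A by move/H; apply.
elim=> {w k v}.
- by move=> k _; exists 0; rewrite scale0r.
- by move=> k r ->; exists r; rewrite od0.
- move=> k v w _ IHv _ IHw k0; have [r ->] := IHv k0; have [s ->] := IHw k0.
  by exists (r + s); rewrite scalerDl.
move=> i j v w _ IHv _ IHw /eqP; rewrite addn_eq0.
move=> /andP[/eqP i0 /eqP j0]; have [r ->] := IHv i0.
have [s ->] := IHw j0.
by exists (r * s); rewrite -scalerAl mul1r scalerA.
Qed.

(** A product of total degree 1 has one factor of degree 0, which is a scalar, and one of degree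
    1. *)
Lemma homog1P w : homog 1 w -> exists v, w = oval (@kaehler_deg1 K R v).
Proof.
suff H k v : homog k v -> k = 1%N -> exists u, v = oval (@kaehler_deg1 K R u).
  by move/H; apply.
elim=> {w k v}.
- by move=> k _; exists 0; rewrite (morphD0 kaehler_deg1D).
- by move=> k r ->; exists (kd r); rewrite kaehler_deg1_kd.
- move=> k v w _ IHv _ IHw k1; have [r ->] := IHv k1; have [s ->] := IHw k1.
  by exists (r + s); rewrite kaehler_deg1D.
move=> [|[|i]] [|[|j]] //= v w hv IHv hw IHw _.
  have [r ->] := homog0P hv; have [s ->] := IHw erefl.
  by exists (r *: s); rewrite kaehler_deg1Z /= mulr_algl.
have [r ->] := homog0P hw; have [s ->] := IHv erefl.
by exists (r *: s); rewrite kaehler_deg1Z /= mulrC mulr_algl.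
Qed.

Lemma kaehler_deg1_bij : bijective (@kaehler_deg1 K R).
Proof.
have injk : injective (@kaehler_deg1 K R).
  by move=> v w vw; rewrite -[v]kaehler_deg1K vw kaehler_deg1K.
exists (fun w => Omega_kaehler (oval w)); first exact: kaehler_deg1K.
move=> w; apply: val_inj => /=; case: w => w /= /asboolP /homog1P[v ->].
by rewrite kaehler_deg1K.
Qed.

(** Existence is transported from [kaehler R] through the bijection; uniqueness holds because the
    elements r ds generate additively. *)
Lemma od1_universal : universal_derivation (@od1 K R).
Proof.
split=> [|N e eP]; first exact: od1_derivation.
have [g gK Kg] := kaehler_deg1_bij.
have el := kaehler_ext_linear eP.
exists (fun w => kaehler_ext e (g w)); split.
  split=> [r v w|r]; last by rewrite -kaehler_deg1_kd gK kaehler_ext_kd.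
  rewrite -[v]Kg -[w]Kg -kaehler_deg1_linear !gK; exact: el.
move=> f [flin fd]; apply: funext => w; rewrite -[w in RHS]Kg.
have fD : {morph f : x y / x + y}.
  by move=> x y; have := flin 1 x y; rewrite !scale1r.
have fZ r x : f (r *: x) = r *: f x.
  by have := flin r x 0; rewrite !addr0 (morphD0 fD) addr0.
have eD : {morph kaehler_ext e : x y / x + y}.
  by move=> x y; have := el 1 x y; rewrite !scale1r.
have eZ r x : kaehler_ext e (r *: x) = r *: kaehler_ext e x.
  by have := el r x 0; rewrite !addr0 (morphD0 eD) addr0.
elim/kaehler_ind: (g w) => [r s|x y IHx IHy].
  by rewrite kaehler_deg1Z fZ eZ kaehler_deg1_kd fd kaehler_ext_kd.
by rewrite kaehler_deg1D fD eD IHx IHy.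
Qed.

Variable M : lmodType R.
Local Notation OM := (tensor (Omega R) M).

Lemma tensor_deg1_tens w m :
  @tensor_deg1 K R M (tens w m) = tens (oval (kaehler_deg1 w)) m.
Proof. exact: tensor_ext_tens (@tensor_deg1_balanced _ _ _) _ _. Qed.

Lemma tensor_deg1D : {morph @tensor_deg1 K R M : x y / x + y}.
Proof. exact: tensor_extD (@tensor_deg1_balanced _ _ _). Qed.

Definition tensor_proj1 : OM -> tensor (kaehler R) M :=
  tensor_ext (fun w m => tens (Omega_kaehler w) m).

Let tensor_proj1_balanced :
  balanced (fun w (m : M) => tens (Omega_kaehler w) m).
Proof.
split=> [v w m|w m n|r w m]; first by rewrite Omega_kaehlerD tensDl.
  exact: tensDr.
by rewrite Omega_kaehlerZ tens_bal.
Qed.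

(** Tensoring need not preserve injectivity, but it preserves a linear retraction; hence
    [tensor_deg1] is injective for every M. *)
Lemma tensor_deg1K : cancel (@tensor_deg1 K R M) tensor_proj1.
Proof.
have pD : {morph tensor_proj1 : x y / x + y}.
  exact: tensor_extD tensor_proj1_balanced.
elim/tensor_ind => [|w m|x y IHx IHy].
- by rewrite (morphD0 tensor_deg1D) (morphD0 pD).
- rewrite tensor_deg1_tens /tensor_proj1.
  by rewrite (tensor_ext_tens tensor_proj1_balanced) kaehler_deg1K.
- by rewrite tensor_deg1D pD IHx IHy.
Qed.

Lemma thomog1P (x : OM) : thomog 1 x <-> exists w, tensor_deg1 w = x.
Proof.
split=> [|[w <-]].
  elim=> [|w m hw|y z _ [v <-] _ [w <-]].
  - by exists 0; rewrite (morphD0 tensor_deg1D).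
  - by have [v ->] := homog1P hw; exists (tens v m); rewrite tensor_deg1_tens.
  - by exists (v + w); rewrite tensor_deg1D.
elim/tensor_ind: w => [|w m|x' y IHx IHy].
- by rewrite (morphD0 tensor_deg1D); exact: thomog_0.
- rewrite tensor_deg1_tens; apply: thomog_tens.
  by case: (kaehler_deg1 w) => ? /= /asboolP.
- by rewrite tensor_deg1D; exact: thomog_D.
Qed.

End DegreeOne.

(** * Tensors with a zero factor *)

Section TensorLemmas.
Variables (R : comNzRingType) (N M : lmodType R).

Lemma tens0l (m : M) : tens (0 : N) m = 0.
Proof. exact: (morphD0 (f := fun x : N => tens x m) (fun x y => tensDl x y m)). Qed.

End TensorLemmas.

(** * The derivation of degree one underlying d_Omega *)

Section GradedDerivation.
Variables (K : fieldType) (R : comAlgType K).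
Implicit Types (r : R) (v w : Omega R).

Lemma dOmegaD : {morph @dOmega K R : v w / v + w}.
Proof. exact: Omega_extD (dOmega_data R). Qed.

Lemma dOmegaM : {morph @dOmega K R : v w / v * w}.
Proof. exact: Omega_extM (dOmega_data R). Qed.

Lemma dOmega_od k r j : dOmega (od k r) j = od (k + j) r *+ 'C(k + j, j).
Proof. by rewrite /dOmega (Omega_ext_od _ _ (dOmega_data R)). Qed.

Lemma dOmega0 w : dOmega w 0%N = w.
Proof.
elim/Omega_ind: w => [k r|v w IHv IHw|v w IHv IHw].
- by rewrite dOmega_od addn0 bin0.
- by rewrite dOmegaD seriesD IHv IHw.
- by rewrite dOmegaM seriesM big_ord1 IHv IHw.
Qed.

Lemma dOmega1D : {morph (fun w => dOmega w 1%N) : v w / v + w}.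
Proof. by move=> v w; rewrite dOmegaD. Qed.

Lemma dOmega1M v w :
  dOmega (v * w) 1%N = dOmega v 1%N * w + v * dOmega w 1%N.
Proof.
by rewrite dOmegaM seriesM big_ord_recr big_ord1 /= subn0 subnn !dOmega0 addrC.
Qed.

(** So d_Omega is the exponential of its degree-one part. On generators this is (n+1) C(k+n+1, n+1)
    = (k+n+1) C(k+n, n); products follow by the Leibniz rule. *)
Lemma dOmega_rec w n : dOmega w n.+1 *+ n.+1 = dOmega (dOmega w n) 1%N.
Proof.
elim/Omega_ind: w n => [k r|v w IHv IHw|v w IHv IHw] n.
- rewrite !dOmega_od (morphDMn dOmega1D) dOmega_od addn1 bin1 addnS -!mulrnA.
  congr (_ *+ _); rewrite mulnC.
  by rewrite -mul_bin_diag.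
- by rewrite !dOmegaD !seriesD mulrnDl IHv IHw.
rewrite dOmegaM -[LHS]/(sderiv (dOmega v * dOmega w) n) sderivM.
rewrite seriesD !seriesM (morphD_sum dOmega1D) -big_split /=.
by apply: eq_bigr => i _; rewrite dOmega1M /sderiv IHv IHw.
Qed.

Lemma homog_sum k n (F : 'I_n -> Omega R) :
  (forall i, homog k (F i)) -> homog k (\sum_i F i).
Proof.
by move=> hF; apply: big_ind => //; [exact: homog_0 | exact: homog_D].
Qed.

Lemma homogMn k w n : homog k w -> homog k (w *+ n).
Proof.
move=> hw; elim: n => [|n IH]; first exact: homog_0.
by rewrite mulrS; exact: homog_D.
Qed.

Lemma homog_dOmega k w j : homog k w -> homog (k + j) (dOmega w j).
Proof.
move=> hw; elim: hw j => {k w} [k|k r|k v w _ IHv _ IHw|p q v w _ IHv _ IHw] j.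
- by rewrite (morphD0 dOmegaD); exact: homog_0.
- by rewrite dOmega_od; apply: homogMn; exact: homog_d.
- by rewrite dOmegaD; exact: homog_D.
rewrite dOmegaM seriesM; apply: homog_sum => i.
have -> : (p + q + j = (p + i) + (q + (j - i)))%N.
  by have := ltn_ord i; lia.
exact: homog_M.
Qed.

End GradedDerivation.

(** * Iterative connections and their degree-one parts *)

Section IterativeConnections.
Variables (K : fieldType) (R : comAlgType K) (M : lmodType R).
Hypothesis K_char0 : [pchar K] =i pred0.
Local Notation OM := (tensor (Omega R) M).
Implicit Types (r : R) (v w : Omega R) (x y z : OM) (m : M).

Lemma oact_alg r z : oact (r%:A) z = r *: z.
Proof.
elim/tensor_ind: z => [|w m|x y IHx IHy].
- by rewrite oact0r scaler0.
- by rewrite oact_tens mulr_algl tensZ.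
- by rewrite oactDr IHx IHy scalerDr.
Qed.

Lemma oact1 z : oact 1 z = z.
Proof. by rewrite -[1](scale1r (1 : Omega R)) oact_alg scale1r. Qed.

Lemma tensor_deg1Z r (u : tensor (kaehler R) M) :
  @tensor_deg1 K R M (r *: u) = r *: tensor_deg1 u.
Proof.
elim/tensor_ind: u => [|w m|u u' IHu IHu'].
- by rewrite scaler0 (morphD0 (@tensor_deg1D _ _ _)) scaler0.
- by rewrite tensZ !tensor_deg1_tens kaehler_deg1Z tensZ.
- by rewrite scalerDr !tensor_deg1D IHu IHu' scalerDr.
Qed.

Lemma thomogZ k r z : thomog k z -> thomog k (r *: z).
Proof.
elim=> [|w m hw|x y _ hx _ hy]; first by rewrite scaler0; exact: thomog_0.
  by rewrite tensZ; apply: thomog_tens; exact: homogZ.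
by rewrite scalerDr; exact: thomog_D.
Qed.

Lemma thomog_oact i j w z : homog i w -> thomog j z -> thomog (i + j) (oact w z).
Proof.
move=> hw; elim=> [|v m hv|x y _ hx _ hy]; first by rewrite oact0r; exact: thomog_0.
  by rewrite oact_tens; apply: thomog_tens; exact: homog_M.
by rewrite oactDr; exact: thomog_D.
Qed.

Section HigherConnection.
Variable nabla : M -> series OM.
Hypothesis nablaP : higher_connection nabla.

Lemma Omega_nabla_tens i w m :
  Omega_nabla nabla i (tens w m) = sact (@oact K R M) (dOmega w) (nabla m) i.
Proof. exact: tensor_ext_tens (Omega_nabla_balanced i nablaP) _ _. Qed.

Lemma Omega_nablaD i : {morph Omega_nabla nabla i : x y / x + y}.
Proof. exact: tensor_extD (Omega_nabla_balanced i nablaP). Qed.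

(** Both sides are d_R(1) nabla(m), as d_Omega agrees with d_R in degree 0. Through it the iteration
    rule for [Omega_nabla] is read off on [nabla]. *)
Lemma Omega_nabla_tens1 i m : Omega_nabla nabla i (tens 1 m) = nabla m i.
Proof.
rewrite Omega_nabla_tens -[in RHS](scale1r m).
have [_ _ -> _] := nablaP; congr (sact _ _ _ _); apply: funext => j.
by rewrite -[1](scale1r (1 : Omega R)) -od0 dOmega_od add0n binn.
Qed.

(** Only nabla^(1) occurs on the right, which is why it determines an iterative connection. *)
Lemma Omega_nabla1_tens w m :
  Omega_nabla nabla 1 (tens w m) =
  oact w (nabla m 1%N) + tens (dOmega w 1%N) m.
Proof.
rewrite Omega_nabla_tens /sact big_ord_recr big_ord1 /= subn0 subnn dOmega0.
by have [_ _ _ ->] := nablaP; rewrite oact_tens mulr1.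
Qed.

(** The Leibniz rule is the degree-one component of nabla(r m) = d_R(r) nabla(m), pulled back along
    the injection [tensor_deg1]. *)
Lemma higher_connection1 (c : M -> tensor (kaehler R) M) :
  (forall m, tensor_deg1 (c m) = nabla m 1%N) -> connection c.
Proof.
move=> cP; have [nB _ nZ n0] := nablaP.
have cZ r m : c (r *: m) = tens (kd r) m + r *: c m.
  apply: (can_inj (@tensor_deg1K _ _ _)).
  rewrite cP nZ tensor_deg1D tensor_deg1Z tensor_deg1_tens kaehler_deg1_kd /= cP.
  rewrite /sact big_ord_recr big_ord1 /= subn0 subnn n0 od0 oact_alg oact_tens.
  by rewrite mulr1 addrC.
split=> // [m m'|a m].
  by apply: (can_inj (@tensor_deg1K _ _ _)); rewrite tensor_deg1D !cP (zmod_morphD nB).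
rewrite cZ (_ : kd _ = 0) ?tens0l ?add0r //.
apply: (can_inj (@kaehler_deg1K _ _)); rewrite kaehler_deg1_kd.
rewrite (morphD0 (@kaehler_deg1D _ _)); exact: odC.
Qed.

Lemma connection_of_higher :
  exists c : M -> tensor (kaehler R) M,
    connection c /\ forall m, tensor_deg1 (c m) = nabla m 1%N.
Proof.
exists (fun m => tensor_proj1 (nabla m 1%N)).
have cP m : tensor_deg1 (tensor_proj1 (nabla m 1%N)) = nabla m 1%N.
  have [_ /(_ m 1%N)/thomog1P[w <-] _ _] := nablaP.
  by rewrite tensor_deg1K.
by split=> //; exact: higher_connection1.
Qed.

End HigherConnection.

Lemma iterative_recl nabla : iterative_connection nabla ->
  forall m n, nabla m n.+1 *+ n.+1 = Omega_nabla nabla 1 (nabla m n).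
Proof.
move=> [nH nI] m n; rewrite -!(Omega_nabla_tens1 nH) nI.
by rewrite add1n bin1.
Qed.

(** Here nabla^(1) is applied first; this reading yields the differential equation of
    [nabla_at_log], while [iterative_recl] yields uniqueness. *)
Lemma iterative_recr nabla : iterative_connection nabla ->
  forall m n, nabla m n.+1 *+ n.+1 = Omega_nabla nabla n (nabla m 1%N).
Proof.
move=> [nH nI] m n; rewrite -!(Omega_nabla_tens1 nH) nI.
by rewrite addn1 binSn.
Qed.

Lemma iterative_unique nabla nabla' :
  iterative_connection nabla -> iterative_connection nabla' ->
  (forall m, nabla m 1%N = nabla' m 1%N) -> nabla = nabla'.
Proof.
move=> nI n'I eq1; have [nH _] := nI; have [n'H _] := n'I.
have eqO z : Omega_nabla nabla 1 z = Omega_nabla nabla' 1 z.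
  elim/tensor_ind: z => [|w m|x y IHx IHy].
  - by rewrite !(morphD0 (Omega_nablaD _ _)).
  - by rewrite !Omega_nabla1_tens // eq1.
  - by rewrite !Omega_nablaD // IHx IHy.
apply: funext => m; apply: funext; elim=> [|n IH].
  by have [_ _ _ ->] := nH; have [_ _ _ ->] := n'H.
apply: (lmod_torsion_free K_char0 (n := n)).
by rewrite (iterative_recl nI) (iterative_recl n'I) IH eqO.
Qed.

(** * Extension of a connection to an iterative connection *)

Section Existence.
Variable c : M -> tensor (kaehler R) M.
Hypothesis cP : connection c.

Let n1 m : OM := tensor_deg1 (c m).

Let n1D : {morph n1 : m m' / m + m'}.
Proof. by move=> m m'; rewrite /n1; case: cP => -> _ _; exact: tensor_deg1D. Qed.

Let n1Z r m : n1 (r *: m) = tens (od 1 r) m + r *: n1 m.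
Proof.
rewrite /n1; case: cP => _ _ ->; rewrite tensor_deg1D tensor_deg1Z.
by rewrite tensor_deg1_tens kaehler_deg1_kd.
Qed.

(* The degree-one part of the connection, extended to a derivation over
   w |-> dOmega w 1; the iterative connection is its exponential. *)
Let Dn : OM -> OM :=
  tensor_ext (fun w m => oact w (n1 m) + tens (dOmega w 1%N) m).

(** The term w d^(1)r (x) m comes from [dOmega] on one side and from the connection on the other, so
    it is the sum that is balanced. *)
Let Dn_balanced :
  balanced (fun w m => oact w (n1 m) + tens (dOmega w 1%N) m).
Proof.
split=> [v w m|w m m'|r w m].
- by rewrite oactDl dOmegaD seriesD tensDl addrACA.
- by rewrite n1D oactDr tensDr addrACA.
have Dr : dOmega (r%:A : Omega R) 1%N = od 1 r by rewrite -od0 dOmega_od binn.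
rewrite n1Z oactDr oact_tens -(oact_alg r (n1 m)) -oactA.
rewrite -[r *: w]mulr_algl dOmega1M Dr tensDl [w * r%:A]mulrC [w * od 1 r]mulrC.
by rewrite [r%:A * dOmega w _]mulr_algl tens_bal addrCA addrA.
Qed.

Let DnD : {morph Dn : x y / x + y}.
Proof. exact: tensor_extD Dn_balanced. Qed.

Let Dn_tens w m : Dn (tens w m) = oact w (n1 m) + tens (dOmega w 1%N) m.
Proof. exact: tensor_ext_tens Dn_balanced _ _. Qed.

Let Dn_oact w z : Dn (oact w z) = oact (dOmega w 1%N) z + oact w (Dn z).
Proof.
elim/tensor_ind: z => [|v m|x y IHx IHy].
- by rewrite (morphD0 DnD) !oact0r (morphD0 DnD) addr0.
- rewrite !oact_tens !Dn_tens dOmega1M oactDr oactA oact_tens tensDl.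
  by rewrite addrCA.
- by rewrite !(oactDr, DnD) IHx IHy addrACA.
Qed.

Let thomog_Dn k z : thomog k z -> thomog k.+1 (Dn z).
Proof.
elim=> [|w m hw|x y _ hx _ hy]; last by rewrite DnD; exact: thomog_D.
  by rewrite (morphD0 DnD); exact: thomog_0.
rewrite Dn_tens -addn1; apply: thomog_D.
  by apply: thomog_oact => //; apply/thomog1P; exists (c m).
by apply: thomog_tens; exact: homog_dOmega.
Qed.

Let nabla m : series OM := exp_Der_over Dn (tens 1 m).

Let nablaP m n : nabla m n *+ n`! = iter n Dn (tens 1 m).
Proof. exact: exp_Der_overP. Qed.

Let nabla_rec m n : nabla m n.+1 *+ n.+1 = Dn (nabla m n).
Proof. exact: exp_Der_over_rec. Qed.

Let nabla0 m : nabla m 0%N = tens 1 m.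
Proof. by rewrite -[LHS]mulr1n -[1%N]/(0`!)%N nablaP. Qed.

(** Identifies d_Omega(w) nabla(m) with the exponential of [Dn] at w (x) m, by [exp_sact]. Both the
    Leibniz rule and the iterativity of [nabla] follow. *)
Let iter_sact w m n :
  sact (@oact K R M) (dOmega w) (nabla m) n *+ n`! = iter n Dn (tens w m).
Proof.
rewrite (iter_recP DnD).
  by rewrite /sact big_ord1 dOmega0 nabla0 oact_tens mulr1.
apply: (exp_sact (dA := fun w => dOmega w 1%N)) => //.
- exact: oactDl.
- exact: oactDr.
- exact: dOmega_rec.
Qed.

Let nabla_higher : higher_connection nabla.
Proof.
split.
- apply: morphDB => m m'; apply: funext => n.
  by rewrite seriesD /nabla /exp_Der_over tensDr (iterDP DnD) scalerDr.
- move=> m k; apply: thomogZ; elim: k => [|k IH]; last exact: thomog_Dn.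
  by apply: thomog_tens; rewrite -[1](scale1r (1 : Omega R)) -od0; exact: homog_d.
- move=> r m; apply: funext => n.
  apply: (mulrn_fact_inj (@lmod_torsion_free _ _ K_char0 _) (n := n)).
  (* Since 1 (x) r m = d^(0)r (x) m, [iter_sact] applies with w = d^(0)r. *)
  rewrite nablaP -tens_bal -od0 -iter_sact; congr (sact _ _ _ _ *+ _).
  by apply: funext => j; rewrite dOmega_od add0n binn.
- exact: nabla0.
Qed.

Lemma iterative_exists :
  exists nabla : M -> series OM, iterative_connection nabla /\
    forall m, tensor_deg1 (c m) = nabla m 1%N.
Proof.
exists nabla; split=> [|m]; last first.
  rewrite -[RHS]mulr1n -[1%N]/(1`!)%N nablaP /= Dn_tens oact1.
  rewrite -[1](scale1r (1 : Omega R)) -od0 dOmega_od binn.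
  by rewrite -[1](scale1r (1 : R)) odC tens0l addr0.
split; first exact: nabla_higher.
apply: (divided_iterate (@lmod_torsion_free _ _ K_char0 _) DnD).
move=> n z; elim/tensor_ind: z => [|w m|x y IHx IHy].
- rewrite (morphD0 (Omega_nablaD nabla_higher _)).
  by rewrite (morphD0 (iterDP DnD n)) mul0rn.
- by rewrite (Omega_nabla_tens nabla_higher) iter_sact.
- by rewrite (Omega_nablaD nabla_higher) (iterDP DnD) mulrnDl IHx IHy.
Qed.

End Existence.
End IterativeConnections.

(** * Logarithmic derivatives of families of additive maps *)

Section LogarithmicDerivative.
Variable V : zmodType.

Lemma sext_const (F : V -> series V) x : {morph F : y z / y + z} ->
  sext F (smonomial x 0%N) = F x.
Proof.
move=> FD; apply: funext => n; rewrite /sext big_ord_recl /= subn0 big1 ?addr0 //.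
by move=> i _; rewrite /smonomial /= (morphD0 FD).
Qed.

Lemma scompD (F G : V -> series V) : {morph F : x y / x + y} ->
  {morph G : x y / x + y} -> {morph scomp F G : x y / x + y}.
Proof. by move=> FD GD x y; rewrite /scomp GD sextD. Qed.

(* The gauge transformation rule for the logarithmic derivative C = F^-1 F'. *)
Lemma sderiv_scomp (F1 F2 A1 A2 B : V -> series V) :
  {morph F1 : x y / x + y} -> {morph F2 : x y / x + y} ->
  (forall x, sderiv (F1 x) = sext F1 (A1 x)) ->
  (forall x, sderiv (F2 x) = sext F2 (A2 x)) ->
  (forall x, sext A1 (F2 x) = sext F2 (B x)) ->
  forall x, sderiv (scomp F1 F2 x) = sext (scomp F1 F2) (B x + A2 x).
Proof.
move=> F1D F2D F1' F2' A1F2 x; rewrite /scomp sderiv_sext // F2'.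
have -> : sext (fun x => sderiv (F1 x)) (F2 x) = sext F1 (sext A1 (F2 x)).
  by rewrite sext_scomp //; congr (sext _ _); apply: funext => y; exact: F1'.
by rewrite A1F2 -sextD // -sextD // sext_scomp.
Qed.

(* The terms of order 2 of the Baker-Campbell-Hausdorff formula. *)
Lemma scomp_exp_log (F1 F2 C : V -> series V) (A1 A2 : V -> V) :
  {morph F1 : x y / x + y} ->
  {morph A1 : x y / x + y} -> {morph A2 : x y / x + y} ->
  (forall x, F1 x 0%N = x) -> (forall x, F2 x 0%N = x) ->
  (forall x, sderiv (F1 x) = F1 (A1 x)) ->
  (forall x, sderiv (F2 x) = F2 (A2 x)) ->
  (forall x, sderiv (scomp F1 F2 x) = sext (scomp F1 F2) (C x)) ->
  forall x, C x 1%N = A1 (A2 x) - A2 (A1 x).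
Proof.
move=> F1D A1D A2D F10 F20 F1' F2' FC x.
have F11 y : F1 y 1%N = A1 y by rewrite -(F10 (A1 y)) -F1'.
have F21 y : F2 y 1%N = A2 y by rewrite -(F20 (A2 y)) -F2'.
have F12 y : F1 y 2%N *+ 2 = A1 (A1 y) by rewrite -F11 -F1'.
have F22 y : F2 y 2%N *+ 2 = A2 (A2 y) by rewrite -F21 -F2'.
have F0 y : scomp F1 F2 y 0%N = y.
  by rewrite /scomp /sext big_ord1 F20 F10.
have F_1 y : scomp F1 F2 y 1%N = A1 y + A2 y.
  by rewrite /scomp /sext big_ord_recr big_ord1 /= subn0 subnn F20 F10 F11 F21.
have C0 y : C y 0%N = A1 y + A2 y.
  by rewrite -F_1 -[RHS]/(sderiv (scomp F1 F2 y) 0%N) FC /sext big_ord1 F0.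
have F_2 y : scomp F1 F2 y 2%N *+ 2 = A1 (A1 y) + A1 (A2 y) *+ 2 + A2 (A2 y).
  rewrite /scomp /sext !big_ord_recr big_ord0 /= add0r F20 F10 F11 F21.
  by rewrite !mulrnDl F12 F22.
(* The coefficient of T reads A1^2 + 2 A1 A2 + A2^2 = (A1 + A2)^2 + C_1, which leaves the
   commutator. *)
have := congr1 (fun g => g 1%N) (FC x).
rewrite {1}/sderiv /= F_2 /sext big_ord_recr big_ord1 /= F0 F_1 C0 A1D A2D.
rewrite -[LHS]addrA -[RHS]addrA -[X in _ = X]addrA => /addrI.
rewrite mulr2n -addrA => /addrI.
rewrite addrC -addrA addrCA => /addrI ->; rewrite [A2 _ + _]addrC addrK //.
Qed.

End LogarithmicDerivative.

(** * Higher derivations: logarithmic derivative and conjugation *)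

Section HigherDerivations.
Variables (K : fieldType) (R : comAlgType K).
Implicit Types (psi : R -> series R) (M : lmodType R).

(** The shape of a logarithmic derivative of a higher derivation: a derivation from R to R[[T]],
    given by its coefficients. *)
Definition Der_series (D : R -> series R) := forall k, Der (D^~ k : R -> R).

Lemma Der_seriesD D : Der_series D -> {morph D : r s / r + s}.
Proof. by move=> DP r s; apply: funext => n; exact: DerD (DP n) r s. Qed.

Lemma Der_sum n (d : 'I_n -> R -> R) : (forall i, Der (d i)) ->
  Der (fun r => \sum_i d i r).
Proof.
move=> dP; split=> [r s|a r|r s].
- by rewrite -big_split; apply: eq_bigr => i _; exact: DerD (dP i) r s.
- rewrite scaler_sumr; apply: eq_bigr => i _; case: (dP i) => _ -> //.
- rewrite !scaler_sumr -big_split; apply: eq_bigr => i _.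
  by case: (dP i) => _ _ ->.
Qed.

Lemma Der_add d1 d2 : Der d1 -> Der d2 -> Der (fun r : R => d1 r + d2 r).
Proof.
move=> d1P d2P; split=> [r s|a r|r s].
- by rewrite (DerD d1P) (DerD d2P) addrACA.
- by rewrite scalerDr; case: d1P => _ -> _; case: d2P => _ -> _.
- by rewrite !scalerDr addrACA; case: d1P => _ _ ->; case: d2P => _ _ ->.
Qed.

Lemma Der_zero : Der (fun=> 0 : R).
Proof. by split=> [r s|a r|r s]; rewrite ?scaler0 ?addr0. Qed.

Lemma Der_Mn d n : Der d -> Der (fun r : R => d r *+ n).
Proof.
move=> dP; split=> [r s|a r|r s].
- by rewrite (DerD dP) mulrnDl.
- by rewrite -scalerMnr; case: dP => _ -> _.
- by rewrite -!scalerMnr -mulrnDl; case: dP => _ _ ->.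
Qed.

Lemma Der_bracket d1 d2 : Der d1 -> Der d2 -> Der (bracket d1 d2 : R -> R).
Proof.
move=> d1P d2P; split=> [r s|a r|r s]; rewrite /bracket.
- by rewrite !(DerD d1P, DerD d2P) opprD addrACA.
- by rewrite !(DerZ d1P, DerZ d2P) -scalerBr -[LHS]mulr_algl.
- rewrite !(DerM d1P, DerM d2P) !(DerD d1P, DerD d2P) !(DerM d1P, DerM d2P).
  rewrite -[r *: _]/(r * _) -[s *: _]/(s * _); ring.
Qed.

Section Semilinear.
Variables (psi : R -> series R) (M : lmodType R) (N : M -> series M).
Hypothesis NZ : forall r m, N (r *: m) = sact *:%R (psi r) (N m).

Lemma sext_scale (f : series R) m :
  sext N (fun k => f k *: m) = sact *:%R (sext psi f) (N m).
Proof.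
apply: funext => n; rewrite /sext.
under eq_bigr => i _ do rewrite NZ /sact.
rewrite -(cauchy_sumA (fun a b c => psi (f a) b *: N m c)).
by apply: eq_bigr => i _; rewrite scaler_suml.
Qed.

End Semilinear.

Section OneHigherDerivation.
Variable psi : R -> series R.
Hypothesis psiP : HD psi.

Lemma HD_D : {morph psi : r s / r + s}.
Proof. by case: psiP => /zmod_morphD. Qed.

Lemma HD_0 r : psi r 0%N = r.
Proof. by case: psiP. Qed.

Lemma HD_M : {morph psi : r s / r * s}.
Proof. by case: psiP => _ [_ psiM] _ _. Qed.

Lemma sext_mulr (g : series R) r :
  sext psi (fun k => r * g k) = psi r * sext psi g.
Proof.
rewrite mulrC -[RHS](sext_scale (M := R^o)) => [|s m]; last exact: HD_M.
by congr (sext _ _); apply: funext => k; rewrite mulrC.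
Qed.

Lemma sext_mul (f g : series R) : sext psi (f * g) = sext psi f * sext psi g.
Proof.
apply: funext => n; rewrite seriesM /sext.
under eq_bigr => i _ do rewrite seriesM (morphD_sum (series_coefD HD_D _)).
rewrite (cauchy_sumA (fun a b c => psi (f a * g b) c)).
transitivity (\sum_(i < n.+1) \sum_(j < (n - i).+1)
    psi (f i) j * sext psi g (n - i - j)%N).
  by apply: eq_bigr => i _; rewrite -seriesM -sext_mulr.
rewrite -(cauchy_sumA (fun a b c => psi (f a) b * sext psi g c)).
by apply: eq_bigr => i _; rewrite mulr_suml.
Qed.

Lemma sext_Z (a : K) (g : series R) :
  sext psi (fun k => a *: g k) = fun n => a *: sext psi g n.
Proof.
apply: funext => n; rewrite /sext scaler_sumr; apply: eq_bigr => i _.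
by case: psiP => _ _ -> _.
Qed.

(** As psi[[T]] is bijective, theta = psi[[T]]^-1 X exists. It takes multiplication by psi r back to
    multiplication by r, so the psi-twisted Leibniz rule of X becomes the ordinary one for theta. *)
Lemma HD_derivation_factor (X : R -> series R) :
  {morph X : r s / r + s} -> (forall (a : K) r k, X (a *: r) k = a *: X r k) ->
  (forall r s, X (r * s) = X r * psi s + psi r * X s) ->
  exists theta, Der_series theta /\ forall r, X r = sext psi (theta r).
Proof.
move=> XD XZ XM; have inj := sext_inj HD_0.
have /choice[theta thetaP] r : exists h, X r = sext psi h.
  by have [h] := sext_surj HD_0 (X r); exists h.
exists theta; split=> // k; split=> [r s|a r|r s].
- suff -> : theta (r + s) = theta r + theta s by [].
  by apply: inj; rewrite (sextD HD_D) -!thetaP.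
- suff -> : theta (a *: r) = fun n => a *: theta r n.
    by rewrite -[LHS]mulr_algl.
  apply: inj; rewrite sext_Z -!thetaP; apply: funext => n; exact: XZ.
suff -> : theta (r * s) =
    ((fun n => r * theta s n) : series R) + (fun n => s * theta r n) by [].
apply: inj; rewrite (sextD HD_D) !sext_mulr -!thetaP XM.
by rewrite addrC [X r * _]mulrC.
Qed.

(** Differentiating psi(r s) = psi(r) psi(s) in T shows that psi' is a psi-twisted derivation; theta
    is psi^-1 psi'. *)
Lemma HD_log : exists theta, Der_series theta /\
  forall r, sderiv (psi r) = sext psi (theta r).
Proof.
apply: HD_derivation_factor.
- by move=> r s; rewrite HD_D sderivD.
- by move=> a r k; rewrite /sderiv; case: psiP => _ _ -> _; rewrite scalerMnr.
- by move=> r s; rewrite HD_M sderivM.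
Qed.

Lemma sext_DerM D (f g : series R) : Der_series D ->
  sext D (f * g) = sext D f * g + f * sext D g.
Proof.
move=> DP; apply: funext => n; rewrite seriesD !seriesM /sext.
under eq_bigr => i _ do rewrite seriesM (morphD_sum (DerD (DP _))).
rewrite (cauchy_sumA (fun a b c => D (f a * g b) c)).
transitivity (\sum_(i < n.+1) \sum_(j < (n - i).+1) D (f i) j * g (n - i - j)%N +
    \sum_(i < n.+1) \sum_(j < (n - i).+1) f i * D (g j) (n - i - j)%N).
  rewrite -big_split; apply: eq_bigr => i _ /=.
  rewrite (cauchy_sumC (fun a b => D (f i) a * g b)) -big_split /=.
  by apply: eq_bigr => j _; rewrite (DerM (DP _)).
congr (_ + _); last by apply: eq_bigr => i _; rewrite mulr_sumr.
rewrite -(cauchy_sumA (fun a b c => D (f a) b * g c)).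
by apply: eq_bigr => i _; rewrite mulr_suml.
Qed.

(** [eta] is the conjugate psi^-1 D psi: D[[T]] is a derivation of R[[T]], so D psi is a psi-twisted
    derivation. *)
Lemma HD_conj D : Der_series D -> exists eta, Der_series eta /\
  forall r, sext D (psi r) = sext psi (eta r).
Proof.
move=> DP; apply: HD_derivation_factor.
- by move=> r s; rewrite HD_D (sextD (Der_seriesD DP)).
- move=> a r k; rewrite /sext scaler_sumr; apply: eq_bigr => i _.
  by case: psiP => _ _ -> _; rewrite (DerZ (DP _)).
- by move=> r s; rewrite HD_M sext_DerM.
Qed.

End OneHigherDerivation.

Lemma HD_scomp psi1 psi2 : HD psi1 -> HD psi2 -> HD (scomp psi1 psi2).
Proof.
move=> psi1P psi2P; split.
- exact: morphDB (scompD (HD_D psi1P) (HD_D psi2P)).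
- split; last by move=> r s; rewrite /scomp HD_M // sext_mul.
  rewrite /scomp; case: psi2P => _ [-> _] _ _.
  by rewrite (sext_const _ (HD_D psi1P)); case: psi1P => _ [-> _] _ _.
- move=> a r k; rewrite /scomp -[RHS]/((fun n => a *: sext psi1 (psi2 r) n) k).
  rewrite -sext_Z //; congr (sext _ _ _); apply: funext => n.
  by case: psi2P => _ _ -> _.
- by move=> r; rewrite /scomp /sext big_ord1 !HD_0.
Qed.

End HigherDerivations.

(** * Contraction with derivations and integrability *)

Section Integrability.
Variables (K : fieldType) (R : comAlgType K) (M : lmodType R).
Hypothesis K_char0 : [pchar K] =i pred0.
Local Notation OM := (tensor (Omega R) M).
Local Notation KM := (tensor (kaehler R) M).

Lemma tensor_kaehler_ind (P : KM -> Prop) :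
  (forall r s m, P (tens (r *: kd s) m)) ->
  (forall x y, P x -> P y -> P (x + y)) -> forall x, P x.
Proof.
move=> Pt PD; elim/tensor_ind => [|w m|]; last exact: PD.
  by rewrite -(tens0l _ 0) -(scale0r (kd 0)).
by elim/kaehler_ind: w => // v w Pv Pw; rewrite tensDl; exact: PD.
Qed.

(** [connection_at c d m] is [contract d (c m)]; the dependence on d is thus studied on an arbitrary
    tensor, apart from c. *)
Definition contract (d : R -> R) : KM -> M :=
  tensor_ext (fun w x => (kaehler_ext (d : R -> R^o) w : R) *: x).

Lemma contractD d : Der d -> {morph contract d : x y / x + y}.
Proof. by move=> dP; exact: tensor_extD (connection_at_balanced M dP). Qed.

Lemma contract_tens d r s m : Der d ->
  contract d (tens (r *: kd s) m) = (r * d s) *: m.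
Proof.
move=> dP; rewrite -tensZ.
have -> : r *: tens (kd s) m = tens (kd s) (r *: m) by rewrite tensZ tens_bal.
rewrite /contract (tensor_ext_tens (connection_at_balanced M dP)).
by rewrite (kaehler_ext_kd dP) scalerA mulrC.
Qed.

Lemma contract_add d1 d2 x : Der d1 -> Der d2 ->
  contract (fun r => d1 r + d2 r) x = contract d1 x + contract d2 x.
Proof.
move=> d1P d2P; have dP := Der_add d1P d2P.
elim/tensor_kaehler_ind: x => [r s m|x y IHx IHy].
  by rewrite !contract_tens // mulrDr scalerDl.
by rewrite !contractD // IHx IHy addrACA.
Qed.

Lemma contract_Mn d n x : Der d ->
  contract (fun r => d r *+ n) x = contract d x *+ n.
Proof.
move=> dP; have dnP := Der_Mn n dP.
elim/tensor_kaehler_ind: x => [r s m|x y IHx IHy].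
  by rewrite !contract_tens // mulrnAr scalerMnl.
by rewrite !contractD // IHx IHy mulrnDl.
Qed.

Lemma contract_sum n (d : 'I_n -> R -> R) x : (forall i, Der (d i)) ->
  contract (fun r => \sum_i d i r) x = \sum_i contract (d i) x.
Proof.
move=> dP; have sP := Der_sum dP.
elim/tensor_kaehler_ind: x => [r s m|x y IHx IHy].
  rewrite contract_tens // mulr_sumr scaler_suml.
  by apply: eq_bigr => i _; rewrite contract_tens.
rewrite contractD // IHx IHy -big_split; apply: eq_bigr => i _.
by rewrite contractD.
Qed.

(** * Evaluation of a higher connection at a higher derivation *)

Section Evaluation.
Variable psi : R -> series R.
Hypothesis psiP : HD psi.

Let eval_data : odata id (fun k r => psi r k).
Proof.
case: psiP => psiB [psi1 psiM] psiZ psi0; split=> //.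
- by move=> k r s; rewrite psiB.
- by move=> k a; rewrite psiZ psi1 series1 scaler0.
- by move=> k r s; rewrite psiM.
Qed.

(* [Omega_tilde psi] at T = 1, which loses nothing on homogeneous elements. *)
Definition Omega_eval : Omega R -> R := Omega_ext id (fun k r => psi r k).

Lemma Omega_evalD : {morph Omega_eval : v w / v + w}.
Proof. exact: Omega_extD eval_data. Qed.

Lemma Omega_evalM : {morph Omega_eval : v w / v * w}.
Proof. exact: Omega_extM eval_data. Qed.

Lemma Omega_eval_od k r : Omega_eval (od k r) = psi r k.
Proof. by rewrite /Omega_eval (Omega_ext_od _ _ eval_data). Qed.

Lemma Omega_tilde_homog k w : homog k w ->
  Omega_tilde psi w = smonomial (Omega_eval w) k.
Proof.
have fg := tilde_data psiP; have sm0 j : smonomial 0 j = 0 :> series R.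
  by apply: funext => n; rewrite /smonomial if_same.
elim=> {k w} [k|k r|k v w _ IHv _ IHw|i j v w _ IHv _ IHw].
- by rewrite (morphD0 Omega_evalD) sm0 /Omega_tilde (morphD0 (Omega_extD fg)).
- by rewrite Omega_eval_od /Omega_tilde (Omega_ext_od _ _ fg).
- rewrite /Omega_tilde (Omega_extD fg) -/(Omega_tilde _) IHv IHw Omega_evalD.
  by apply: funext => n; rewrite seriesD /smonomial; case: eqP; rewrite ?addr0.
- rewrite /Omega_tilde (Omega_extM fg) -/(Omega_tilde _) IHv IHw Omega_evalM.
  exact: smonomialM.
Qed.

Definition tensor_eval : OM -> M := tensor_ext (fun w m => Omega_eval w *: m).

Let tensor_eval_balanced : balanced (fun w (m : M) => Omega_eval w *: m).
Proof.
split=> [v w m|w m n|r w m]; first by rewrite Omega_evalD scalerDl.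
  exact: scalerDr.
by rewrite -mulr_algl -od0 Omega_evalM Omega_eval_od HD_0 // mulrC scalerA.
Qed.

Lemma tensor_evalD : {morph tensor_eval : x y / x + y}.
Proof. exact: tensor_extD tensor_eval_balanced. Qed.

Lemma tensor_eval_tens w m : tensor_eval (tens w m) = Omega_eval w *: m.
Proof. exact: tensor_ext_tens tensor_eval_balanced _ _. Qed.

Lemma tensor_eval_oact w x : tensor_eval (oact w x) = Omega_eval w *: tensor_eval x.
Proof.
elim/tensor_ind: x => [|v m|x y IHx IHy].
- by rewrite oact0r (morphD0 tensor_evalD) scaler0.
- by rewrite oact_tens !tensor_eval_tens Omega_evalM scalerA.
- by rewrite oactDr !tensor_evalD IHx IHy scalerDr.
Qed.

Variable nabla : M -> series OM.
Hypothesis nablaP : higher_connection nabla.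
Local Notation N := (nabla_at nabla psi).

(** Homogeneity of [nabla m k] allows one map, independent of k, to compute all coefficients. *)
Lemma nabla_atE m k : N m k = tensor_eval (nabla m k).
Proof.
have bal := nabla_at_balanced M k psiP.
have [_ /(_ m k) + _ _] := nablaP; rewrite /nabla_at.
elim=> [|w m' hw|x y _ IHx _ IHy].
- by rewrite (morphD0 (tensor_extD bal)) (morphD0 tensor_evalD).
- rewrite (tensor_ext_tens bal) tensor_eval_tens (Omega_tilde_homog hw).
  by rewrite /smonomial eqxx.
- by rewrite (tensor_extD bal) tensor_evalD IHx IHy.
Qed.

Lemma nabla_atD : {morph N : m n / m + n}.
Proof.
move=> m n; apply: funext => k; rewrite seriesD !nabla_atE.
by have [nB _ _ _] := nablaP; rewrite (zmod_morphD nB) tensor_evalD.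
Qed.

Lemma nabla_at0 m : N m 0%N = m.
Proof.
have [_ _ _ n0] := nablaP; rewrite nabla_atE n0 tensor_eval_tens.
by rewrite -[1](scale1r (1 : Omega R)) -od0 Omega_eval_od HD_0 // scale1r.
Qed.

Lemma nabla_atZ r m : N (r *: m) = sact *:%R (psi r) (N m).
Proof.
apply: funext => k; have [_ _ nZ _] := nablaP.
rewrite nabla_atE nZ /sact (morphD_sum tensor_evalD); apply: eq_bigr => i _.
by rewrite tensor_eval_oact Omega_eval_od nabla_atE.
Qed.

End Evaluation.

Definition connection_series (c : M -> KM) (D : R -> series R) (m : M) :
  series M := fun k => connection_at c (D^~ k) m.

Section WithConnection.
Variables (nabla : M -> series OM) (c : M -> KM).
Hypothesis nablaI : iterative_connection nabla.
Hypothesis cP : forall m, tensor_deg1 (c m) = nabla m 1%N.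

Let nablaH : higher_connection nabla. Proof. by case: nablaI. Qed.
Let cC : connection c. Proof. exact: (higher_connection1 nablaH cP). Qed.

Local Notation C := (connection_series c).
Local Notation N := (nabla_at nabla).

Lemma connection_atD d : Der d -> {morph connection_at c d : m n / m + n}.
Proof.
move=> dP m n; case: cC => cD _ _; rewrite /connection_at cD.
exact: contractD.
Qed.

Lemma connection_seriesD D : Der_series D -> {morph C D : m n / m + n}.
Proof.
by move=> DP m n; apply: funext => k; exact: connection_atD (DP k) m n.
Qed.

(* The coefficient of T^n of N'(m) is that of degree n + 1 in
   d_Omega(nabla^(1) m), and psi~ maps d_Omega(a db) to psi(a) psi(b)'. *)
Lemma nabla_at_log psi theta : HD psi -> Der_series theta ->
  (forall r, sderiv (psi r) = sext psi (theta r)) ->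
  forall m, sderiv (N psi m) = sext (N psi) (C theta m).
Proof.
move=> psiP thetaP psi' m; apply: funext => n.
rewrite /sderiv nabla_atE // -(morphDMn (tensor_evalD psiP)).
rewrite (iterative_recr nablaI) -cP /C.
rewrite -[RHS]/(sext (N psi) (fun k => contract (theta^~ k) (c m)) n).
have ND := nabla_atD psiP nablaH.
elim/tensor_kaehler_ind: (c m) => [a b x|x y IHx IHy]; last first.
  rewrite tensor_deg1D (Omega_nablaD nablaH) (tensor_evalD psiP) IHx IHy.
  rewrite -seriesD -(sextD ND); congr (sext _ _ _); apply: funext => k.
  by rewrite seriesD contractD.
have -> : (fun k => contract (theta^~ k) (tens (a *: kd b) x)) =
          (fun k => (a * theta b k) *: x).
  by apply: funext => k; rewrite contract_tens.
rewrite (sext_scale (nabla_atZ psiP nablaH)) sext_mulr // -psi'.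
rewrite tensor_deg1_tens kaehler_deg1Z /= kaehler_deg1_kd /=.
rewrite (Omega_nabla_tens nablaH) /sact (morphD_sum (tensor_evalD psiP)).
apply: eq_bigr => i _; rewrite tensor_eval_oact // nabla_atE //.
congr (_ *: _); rewrite -mulr_algl -od0 dOmegaM !seriesM.
rewrite (morphD_sum (Omega_evalD psiP)); apply: eq_bigr => j _.
(* By [binSn], the part of d_Omega(d^(1)b) of order j is (j + 1) d^(j+1)b, whose value is the
   coefficient of T^j in psi(b)'. *)
rewrite Omega_evalM // !dOmega_od add0n binn mulr1n add1n binSn.
by rewrite (morphDMn (Omega_evalD psiP)) !Omega_eval_od.
Qed.

Lemma connection_at_zero m : connection_at c (fun=> 0 : R) m = 0.
Proof.
exact: (contract_Mn 0 (c m) (@Der_zero K R)).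
Qed.

(** * Conjugation by nabla_psi when the connection is flat *)

Section Flatness.
Hypothesis cI : integrable_connection c.
Variables (psi theta : R -> series R).
Hypotheses (psiP : HD psi) (thetaP : Der_series theta).
Hypothesis psi' : forall r, sderiv (psi r) = sext psi (theta r).

Let CthetaD := connection_seriesD thetaP.
Let ND := nabla_atD psiP nablaH.

(** The hypothesis says eta' = eta2 + [eta, theta] for series of derivations; flatness carries this
    relation over to operators on M. *)
Lemma connection_conj_step eta eta' eta2 m :
  Der_series eta -> Der_series eta' -> Der_series eta2 ->
  (forall r, sext theta (eta r) + eta' r = eta2 r + sext eta (theta r)) ->
  sext (C theta) (C eta m) + C eta' m = C eta2 m + sext (C eta) (C theta m).
Proof.
move=> etaP eta'P eta2P eq_eta; apply: funext => k.
pose b (i : 'I_k.+1) := bracket (eta^~ (k - i)%N) (theta^~ i : R -> R).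
have bP i : Der (b i) by exact: Der_bracket.
have -> : C eta' m = fun j => connection_at c (eta'^~ j) m by [].
rewrite !seriesD.
have -> : (eta'^~ k : R -> R) = fun r => eta2 r k + \sum_i b i r.
  apply: funext => r; have := congr1 (fun g => g k) (eq_eta r).
  rewrite !seriesD /sext => /(canRL (addKr _)) ->; rewrite addrCA; congr (_ + _).
  rewrite (cauchy_sumC (fun i j => theta (eta r i) j)) addrC -sumrB.
  by apply: eq_bigr.
rewrite /connection_at -/(contract _ _) contract_add //; last exact: Der_sum.
rewrite contract_sum // addrCA; congr (_ + _).
rewrite /sext (cauchy_sumC (fun i j => C theta (C eta m i) j)) -big_split.
apply: eq_bigr => i _; rewrite /= /C /connection_series.
rewrite -[contract _ _]/(connection_at c (b i) m) -cI // addrC subrK //.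
Qed.

(** Induction on the order in T, for all D and eta at once since D' also occurs. By the induction
    hypothesis the derivatives of the two sides agree once eta' = eta2 + [eta, theta] is known,
    where eta2 = psi^-1 D' psi. *)
Lemma connection_conj D eta : Der_series D -> Der_series eta ->
  (forall r, sext D (psi r) = sext psi (eta r)) ->
  forall m, sext (C D) (N psi m) = sext (N psi) (C eta m).
Proof.
move=> DP etaP Deta m; apply: funext => n.
elim/ltn_ind: n D eta DP etaP Deta m => -[_|n IH] D eta DP etaP Deta m.
  rewrite /sext !big_ord1 !nabla_at0 // /C /connection_series.
  congr (connection_at c _ m); apply: funext => r.
  have := congr1 (fun g => g 0%N) (Deta r).
  by rewrite /sext !big_ord1 !(HD_0 psiP).
apply: (lmod_torsion_free K_char0 (n := n)).
rewrite -[LHS]/(sderiv (sext (C D) (N psi m)) n).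
rewrite -[RHS]/(sderiv (sext (N psi) (C eta m)) n).
have CDD := connection_seriesD DP; have CetaD := connection_seriesD etaP.
have sderivC E : Der_series E ->
    (fun x => sderiv (C E x)) = C (fun r => sderiv (E r)).
  move=> EP; apply: funext => x; apply: funext => k.
  by rewrite /sderiv /C /connection_series -[LHS](contract_Mn _ _ (EP _)).
have sderivP (E : R -> series R) : Der_series E -> Der_series (fun r => sderiv (E r)).
  by move=> EP k; exact: Der_Mn.
have D'P := sderivP _ DP; have eta'P := sderivP _ etaP.
have [eta2 [eta2P D'eta2]] := HD_conj psiP D'P.
have N' := nabla_at_log psiP thetaP psi'.
rewrite (sderiv_sext CDD) (sderiv_sext ND) sderivC // !seriesD.
rewrite (IH n _ _ _ D'P eta2P D'eta2) // N'.
have -> : sext (C D) (sext (N psi) (C theta m)) n =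
          sext (N psi) (sext (C eta) (C theta m)) n.
  rewrite !sext_scomp //; apply: eq_bigr => i _.
  by rewrite /scomp (IH _ _ D eta) // ltnS leq_subr.
have -> : (fun x => sderiv (N psi x)) = scomp (N psi) (C theta).
  by apply: funext => x; exact: N'.
rewrite -sext_scomp // -!seriesD -!(sextD ND).
rewrite -[sderiv (C eta m)]/((fun x => sderiv (C eta x)) m) sderivC //.
congr (sext _ _ n); apply/esym/connection_conj_step => // r.
(* The required relation results from differentiating D psi = psi eta and cancelling psi[[T]]. *)
apply: (sext_inj (HD_0 psiP)); have psiD := HD_D psiP.
have := congr1 (@sderiv R) (Deta r).
rewrite (sderiv_sext (Der_seriesD DP)) (sderiv_sext psiD) psi' D'eta2.
rewrite (sext_scomp (Der_seriesD DP)).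
have -> : scomp D psi = scomp psi eta by apply: funext.
have -> : (fun x => sderiv (psi x)) = scomp psi theta.
  by apply: funext => x; exact: psi'.
by rewrite -!(sext_scomp psiD) -!(sextD psiD).
Qed.

End Flatness.

Lemma integrable_of_connection : integrable_connection c -> integrable nabla.
Proof.
move=> cI psi1 psi2 psi1P psi2P m.
have [theta1 [theta1P psi1']] := HD_log psi1P.
have [theta2 [theta2P psi2']] := HD_log psi2P.
have [eta [etaP theta1eta]] := HD_conj psi2P theta1P.
have psiP := HD_scomp psi1P psi2P.
(* The logarithmic derivative of psi1 psi2 by the gauge rule; the same rule on M produces
   [C theta]. *)
pose theta r : series R := eta r + theta2 r.
have thetaP : Der_series theta by move=> k; exact: Der_add.
have psi' := sderiv_scomp (HD_D psi1P) (HD_D psi2P) psi1' psi2' theta1eta.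
have N1' := nabla_at_log psi1P theta1P psi1'.
have N2' := nabla_at_log psi2P theta2P psi2'.
have N12' := sderiv_scomp (nabla_atD psi1P nablaH) (nabla_atD psi2P nablaH)
  N1' N2' (connection_conj cI psi2P theta2P psi2' theta1P etaP theta1eta).
have CE x : C eta x + C theta2 x = C theta x.
  by apply: funext => k; rewrite seriesD; exact/esym/contract_add.
have -> // : N (scomp psi1 psi2) = scomp (N psi1) (N psi2).
apply: (ode_unique (C := C theta) (@lmod_torsion_free _ _ K_char0 _)).
- by move=> x; rewrite /scomp /sext big_ord1 !nabla_at0.
- exact: nabla_at_log.
- by move=> x; rewrite N12' CE.
Qed.

(** [scomp_exp_log] is applied on R and on M: theta_1 = [d1, d2] for the logarithmic derivative
    theta of exp(d1 T) exp(d2 T), and the coefficient of T in [C theta m] is the commutator of the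
    two operators at m. *)
Lemma connection_of_integrable : integrable nabla -> integrable_connection c.
Proof.
move=> nabla_int d1 d2 d1P d2P m.
have expH (d : R -> R) : Der d -> HD (exp_Der d) by move=> dP; case: (exp_Der_ID K_char0 dP).
have exp' (d : R -> R) : Der d -> forall r, sderiv (exp_Der d r) = exp_Der d (d r).
  move=> dP r; apply: funext => n; apply: (mulrn_fact_inj (alg_torsion_free K_char0) (n := n)).
  by rewrite /sderiv exp_Der_rec // -(morphDMn (DerD dP)) !exp_DerP // -iterS iterSr.
(* The logarithmic derivative of exp(d T) is d, constant in T. *)
pose const (d : R -> R) r : series R := smonomial (d r) 0%N.
have constP (d : R -> R) : Der d -> Der_series (const d).
  by move=> dP [|k] //; exact: Der_zero.
have constC d x : Der d -> C (const d) x = smonomial (connection_at c d x) 0%N.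
  by move=> dP; apply: funext => -[|k] //; exact: connection_at_zero.
have expN' d : Der d -> forall x,
    sderiv (N (exp_Der d) x) = N (exp_Der d) (connection_at c d x).
  move=> dP x; rewrite (nabla_at_log (expH _ dP) (constP _ dP)) ?constC //.
    exact: sext_const (nabla_atD (expH _ dP) nablaH).
  move=> r; rewrite exp' // /const sext_const //; exact: HD_D (expH _ dP).
have psi1P := expH _ d1P; have psi2P := expH _ d2P.
have psiP := HD_scomp psi1P psi2P.
have [theta [thetaP psi']] := HD_log psiP.
have theta1 r := scomp_exp_log (HD_D psi1P) (DerD d1P) (DerD d2P)
  (HD_0 psi1P) (HD_0 psi2P) (exp' _ d1P) (exp' _ d2P) psi' r.
(* Integrability enters here: the composite of the two families inherits the equation with
   logarithmic derivative theta. *)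
have NE : N (scomp (exp_Der d1) (exp_Der d2)) =
          scomp (N (exp_Der d1)) (N (exp_Der d2)).
  by apply: funext => x; exact: nabla_int.
have N' := nabla_at_log psiP thetaP psi'; rewrite NE in N'.
rewrite -(scomp_exp_log (nabla_atD psi1P nablaH) (connection_atD d1P)
  (connection_atD d2P) (nabla_at0 psi1P nablaH) (nabla_at0 psi2P nablaH)
  (expN' _ d1P) (expN' _ d2P) N' m).
by rewrite /C /connection_series; congr (connection_at c _ m); apply: funext.
Qed.

End WithConnection.
End Integrability.

(** * Assembly of (i), (ii) and (iii) *)

Theorem proposition7p1 (K : fieldType) (R : comAlgType K) (M : lmodType R)
    (K_char0 : [pchar K] =i pred0)
    (R_domain : GRing.integral_domain_axiom R)
    (R_regular : regular_ring R)
    (R_loc : localization_of_fg_algebra R)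
    (R_point : exists m : {pred R}, maximal_ideal m /\ finite_residue_field m)
    (M_fg : fg_module M) :
  (* (i) *)
  (inverse_bijections (@Der K R) (@ID K R)
     (@exp_Der K R) (fun phi r => phi r 1%N) /\
   forall d : R -> R, Der d ->
     inverse_bijections (@Der_over K R d M) (ID_over (exp_Der d))
       (@exp_Der_over K R M) (fun Phi m => Phi m 1%N))
  /\
  (* (ii) *)
  ([/\ linear (@kaehler_deg1 K R),
       bijective (@kaehler_deg1 K R),
       forall r : R, kaehler_deg1 (kd r) = od1 r &
       universal_derivation (@od1 K R)])
  /\
  (* (iii) *)
  [/\ injective (@tensor_deg1 K R M) /\
      (forall x : tensor (Omega R) M,
         thomog 1 x <-> exists w, tensor_deg1 w = x),
      forall nabla : M -> series (tensor (Omega R) M),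
        iterative_connection nabla ->
        exists c : M -> tensor (kaehler R) M,
          connection c /\ forall m, tensor_deg1 (c m) = nabla m 1%N,
      forall c : M -> tensor (kaehler R) M, connection c ->
        exists! nabla : M -> series (tensor (Omega R) M),
          iterative_connection nabla /\
          forall m, tensor_deg1 (c m) = nabla m 1%N &
      forall (nabla : M -> series (tensor (Omega R) M))
             (c : M -> tensor (kaehler R) M),
        iterative_connection nabla ->
        (forall m, tensor_deg1 (c m) = nabla m 1%N) ->
        (integrable nabla <-> integrable_connection c)].
Proof.
split; [|split; [|split]].
- by split=> [|d dP]; [exact: exp_Der_bij | exact: exp_Der_over_bij].
- split; first exact: kaehler_deg1_linear.
  + exact: kaehler_deg1_bij.
  + exact: kaehler_deg1_kd.
  + exact: od1_universal.
- split; first exact: can_inj (@tensor_deg1K K R M).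
  exact: thomog1P.
- by move=> nabla [/connection_of_higher].
- move=> c /(iterative_exists K_char0)[nabla [nablaI cP]].
  exists nabla; split=> // nabla' [nabla'I cP'].
  by apply: iterative_unique => // m; rewrite -cP.
move=> nabla c nablaI cP; split.
  exact: connection_of_integrable.
exact: integrable_of_connection.
Qed.
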